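(* Let $R$ be a prime ring, let $L$ be a noncentral Lie ideal of $R$ (i.e. $L\not\subseteq Z(R)$), and let $m,k\geq 1$ be integers with either $m>1$ or $k>1$. Then $\big[E_m(L)^+,E_k(L)^+\big]=0$ if and only if $R$ is exceptional and $L\subseteq [RC,RC]$.
   Context: Rings are associative, not necessarily unital; $Z(R)$ is the center of $R$. $[a,b]:=ab-ba$; for additive subgroups $A,B$ of a ring, $AB$ (resp. $[A,B]$) is the additive subgroup generated by all $ab$ (resp. $[a,b]$), $a\in A$, $b\in B$. A Lie ideal of $R$ is an additive subgroup $L$ with $[L,R]\subseteq L$. Define $E_1(x)=x$ and $E_{k+1}(x_1,\ldots,x_{k+1}):=[E_k(x_1,\ldots,x_k),x_{k+1}]$ for $k\ge 1$. For a Lie ideal $L$, $E_m(L)^+$ is the additive subgroup of $R$ generated by all $E_m(x_1,\ldots,x_m)$ with $x_i\in L$. For a prime ring $R$, let $Q_s(R)$ be its Martindale symmetric ring of quotients and $C$ (the extended centroid) the center of $Q_s(R)$, which is a field; $RC$ is taken in $Q_s(R)$. A prime ring $R$ is called exceptional if both $\mathrm{char}\,R=2$ and $\dim_C RC=4$. *)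

(* Defs.v *)
From HB Require Import structures.
From mathcomp Require Import all_boot all_order all_algebra.
From mathcomp Require Import all_classical.

Set Implicit Arguments.
Unset Strict Implicit.
Unset Printing Implicit Defensive.

Import GRing.Theory.
Local Open Scope classical_set_scope.
Local Open Scope ring_scope.
Local Open Scope quotient_scope.

Section AdditiveSubgroups.
Variable V : zmodType.

Definition add_subgroup (A : set V) : Prop :=
  A 0 /\ forall x y, A x -> A y -> A (x - y).

Definition add_gen (S : set V) : set V := smallest add_subgroup S.

(* For [op] a product (resp. a commutator), this is AB (resp. [A, B]). *)
Definition add_gen2 (op : V -> V -> V) (A B : set V) : set V :=
  add_gen [set op a b | a in A & b in B].

Lemma add_subgroupN A x : add_subgroup A -> A x -> A (- x).
Proof. by move=> [A0 AB] Ax; rewrite -sub0r; exact: AB. Qed.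

Lemma add_subgroupD A x y : add_subgroup A -> A x -> A y -> A (x + y).
Proof.
move=> sA Ax Ay; rewrite -[y]opprK.
by have [_ AB] := sA; apply: AB => //; exact: add_subgroupN.
Qed.

Lemma add_gen_subgroup S : add_subgroup (add_gen S).
Proof.
split=> [|x y Sx Sy] A [sA SA]; first by have [] := sA.
by have [_ AB] := sA; apply: AB; [exact: Sx | exact: Sy].
Qed.

Lemma sub_add_gen S : S `<=` add_gen S.
Proof. exact: sub_gen_smallest. Qed.

Lemma add_gen_sub S A : add_subgroup A -> S `<=` A -> add_gen S `<=` A.
Proof. exact: smallest_sub. Qed.

End AdditiveSubgroups.

(* The ring structures of the library are all unital.  An associative, not
   necessarily unital, ring is an abelian group with a semigroup product,
   written [(x * y)%g]. *)
HB.mixin Record Zmodule_Semigroup_isRng R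
    of GRing.Zmodule R & Semigroup R := {
  rng_mulDl : forall x y z : R,
    ((x + y)%R * z)%g = (x * z)%g + (y * z)%g;
  rng_mulDr : forall x y z : R,
    (x * (y + z)%R)%g = (x * y)%g + (x * z)%g
}.
#[short(type="rngType")]
HB.structure Definition Rng :=
  {R of GRing.Zmodule R & Semigroup R & Zmodule_Semigroup_isRng R}.

HB.mixin Record Rng_isPrime R of Rng R := {
  prime_rng_nonzero : exists x : R, x <> 0;
  prime_rng_prime : forall a b : R,
    (forall x : R, (a * x * b)%g = 0) -> a = 0 \/ b = 0
}.
#[short(type="primeRngType")]
HB.structure Definition PrimeRng := {R of Rng R & Rng_isPrime R}.

Section Rings.
Variable R : rngType.
Implicit Types (x y z : R) (I J L : set R).

Definition rng_bracket x y : R := (x * y)%g - (y * x)%g.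

Definition rng_center : set R := [set z | forall x, (z * x)%g = (x * z)%g].

Definition lie_ideal L : Prop :=
  add_subgroup L /\ add_gen2 rng_bracket L setT `<=` L.

(* [E m x] is E_m(x_1, ..., x_m), the arguments x_1, ..., x_m being the first
   m terms [x 0], ..., [x m.-1] of the sequence [x]; [E 0 x] is a dummy. *)
Fixpoint E (m : nat) (x : nat -> R) : R :=
  match m with
  | 0 => 0
  | m'.+1 => if m' is 0 then x 0%N else rng_bracket (E m' x) (x m')
  end.

Definition E_plus (m : nat) L : set R :=
  add_gen [set E m x | x in [set x | forall i, (i < m)%N -> L (x i)]].

Definition rng_ideal I : Prop :=
  add_subgroup I /\ forall x r, I x -> I (r * x)%g /\ I (x * r)%g.

Definition nonzero_ideal I : Prop := rng_ideal I /\ exists2 x, I x & x <> 0.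

Lemma rng_mul0r x : (0 * x)%g = 0 :> R.
Proof. by apply: (addrI (0 * x)%g); rewrite -rng_mulDl !addr0. Qed.

Lemma rng_mulr0 x : (x * 0)%g = 0 :> R.
Proof. by apply: (addrI (x * 0)%g); rewrite -rng_mulDr !addr0. Qed.

Lemma rng_mulNr x y : ((- x) * y)%g = - (x * y)%g :> R.
Proof. by apply: (addrI (x * y)%g); rewrite -rng_mulDl !subrr rng_mul0r. Qed.

Lemma rng_mulrN x y : (x * (- y))%g = - (x * y)%g :> R.
Proof. by apply: (addrI (x * y)%g); rewrite -rng_mulDr !subrr rng_mulr0. Qed.

End Rings.

Arguments rng_center R : clear implicits.

Section NonzeroIdeals.
Variable R : primeRngType.
Implicit Types (I J : set R).

Lemma prime_mul_neq0 (a b : R) :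
  a <> 0 -> b <> 0 -> exists r, (a * r * b)%g <> 0.
Proof.
move=> a0 b0; apply: contrapT => /forallNP h.
by have [/a0|/b0] := @prime_rng_prime R a b (fun x => contrapT (h x)).
Qed.

Lemma nonzero_idealT : nonzero_ideal [set: R].
Proof. by have [x x0] := @prime_rng_nonzero R; split => //; exists x. Qed.

Lemma nonzero_idealI I J :
  nonzero_ideal I -> nonzero_ideal J -> nonzero_ideal (I `&` J).
Proof.
move=> [[[I0 IB] IM] [a Ia a0]] [[[J0 JB] JM] [b Jb b0]]; split.
  split; first by split=> // x y [Ix Jx] [Iy Jy]; split; [exact: IB|exact: JB].
  move=> x r [Ix Jx]; have [? ?] := IM x r Ix; have [? ?] := JM x r Jx.
  by split; split.
have [r nz] := prime_mul_neq0 a0 b0; exists (a * r * b)%g => //.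
by split; [rewrite -mulgA; exact: (IM _ _ Ia).2|exact: (JM _ _ Jb).1].
Qed.

Lemma nonzero_idealM I J : nonzero_ideal I -> nonzero_ideal J ->
  nonzero_ideal (add_gen2 (fun x y : R => (x * y)%g) I J).
Proof.
move=> [[sI IM] [a Ia a0]] [[sJ JM] [b Jb b0]]; split.
  split=> [|x r xIJ]; first exact: add_gen_subgroup.
  pose IJ := add_gen2 (fun x y : R => (x * y)%g) I J.
  have [IJ0 IJB] : add_subgroup IJ by exact: add_gen_subgroup.
  suff: [set z | IJ (r * z)%g /\ IJ (z * r)%g] x by [].
  apply: add_gen_sub xIJ.
    split=> [|y z [ry yr] [rz zr]]; first by rewrite /= rng_mulr0 rng_mul0r.
    rewrite /= rng_mulDr rng_mulDl rng_mulrN rng_mulNr.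
    by split; exact: IJB.
  move=> _ [y Iy [z Jz <-]]; split; apply: sub_add_gen.
    exists (r * y)%g; first exact: (IM _ _ Iy).1.
    by exists z; rewrite ?mulgA.
  exists y => //; exists (z * r)%g; last by rewrite mulgA.
  exact: (JM _ _ Jz).2.
have [r nz] := prime_mul_neq0 a0 b0; exists (a * r * b)%g => //.
by apply: sub_add_gen; exists (a * r)%g; [exact: (IM _ _ Ia).2|exists b].
Qed.

End NonzeroIdeals.

(* The Martindale symmetric ring of quotients, as classes of triples
   (I, f, g), with I a nonzero ideal, f : I -> R a morphism of left R-modules
   and g : I -> R a morphism of right R-modules such that f(x)y = xg(y).  The
   class of (I, f, g) is the q with f(x) = xq and g(y) = qy for x, y in I.
   The functions f and g are encoded as total functions, whose values outside
   I are irrelevant. *)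
Section Quotients.
Variable R : primeRngType.

Record quotient_maps (I : set R) (f g : R -> R) : Prop := QuotientMaps {
  qm_ideal : nonzero_ideal I;
  qm_leftD : forall x y, I x -> I y -> f (x + y) = f x + f y;
  qm_leftM : forall r x, I x -> f (r * x)%g = (r * f x)%g;
  qm_rightD : forall x y, I x -> I y -> g (x + y) = g x + g y;
  qm_rightM : forall x r, I x -> g (x * r)%g = (g x * r)%g;
  qm_left_right : forall x y, I x -> I y -> (f x * y)%g = (x * g y)%g
}.

Record qtriple := QTriple {
  qdom : set R;
  qleft : R -> R;
  qright : R -> R;
  qtripleP : quotient_maps qdom qleft qright
}.

Definition qdomP q := qm_ideal (qtripleP q).
Definition qleftD q := qm_leftD (qtripleP q).
Definition qleftM q := qm_leftM (qtripleP q).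
Definition qrightD q := qm_rightD (qtripleP q).
Definition qrightM q := qm_rightM (qtripleP q).
Definition qleft_right q := qm_left_right (qtripleP q).

HB.instance Definition _ := gen_eqMixin qtriple.
HB.instance Definition _ := gen_choiceMixin qtriple.

Implicit Types p q : qtriple.

Definition qequiv_prop p q : Prop :=
  exists J, [/\ nonzero_ideal J, J `<=` qdom p `&` qdom q &
    forall x, J x -> qleft p x = qleft q x /\ qright p x = qright q x].

Definition qequiv p q : bool := `[< qequiv_prop p q >].

Lemma qequiv_refl : reflexive qequiv.
Proof.
by move=> p; apply/asboolP; exists (qdom p); split=> //; exact: qdomP.
Qed.

Lemma qequiv_sym : symmetric qequiv.
Proof.
move=> p q; apply/asbool_equiv_eq; split=> -[J [nJ sJ eJ]]; exists J;
  by split=> [//|x /sJ[]|x /eJ[]].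
Qed.

Lemma qequiv_trans : transitive qequiv.
Proof.
move=> q p r /asboolP[J [nJ sJ eJ]] /asboolP[K [nK sK eK]]; apply/asboolP.
exists (J `&` K); split; first exact: nonzero_idealI.
  by move=> x [/sJ[? _] /sK[_ ?]].
by move=> x [/eJ[-> ->] /eK[-> ->]].
Qed.

Canonical qequiv_equiv := EquivRel qequiv qequiv_refl qequiv_sym qequiv_trans.

Definition Qs : Type := {eq_quot qequiv_equiv}.
HB.instance Definition _ := Choice.on Qs.
HB.instance Definition _ := EqQuotient.on Qs.

Lemma qeqP p q : reflect (qequiv_prop p q) (p == q %[mod Qs]).
Proof. by rewrite eqmodE; exact: asboolP. Qed.

Lemma qeq_fun p q : qleft p =1 qleft q -> qright p =1 qright q ->
  p = q %[mod Qs].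
Proof.
move=> el er; apply/eqP/qeqP; exists (qdom p `&` qdom q); split=> //.
exact: nonzero_idealI (qdomP p) (qdomP q).
Qed.

Lemma qeqD_fun p q J : nonzero_ideal J -> J `<=` qdom p -> J `<=` qdom q ->
  (forall x, J x -> qleft p x = qleft q x /\ qright p x = qright q x) ->
  p = q %[mod Qs].
Proof.
by move=> nJ Jp Jq e; apply/eqP/qeqP; exists J; split=> // x Jx; split; auto.
Qed.

Fact qzero_subproof : quotient_maps setT (fun=> 0) (fun=> 0).
Proof.
split=> *; rewrite ?addr0 ?rng_mul0r ?rng_mulr0 //.
exact: nonzero_idealT.
Qed.
Definition qzero := QTriple qzero_subproof.

Fact qone_subproof : quotient_maps setT id id.
Proof. by split=> //; exact: nonzero_idealT. Qed.
Definition qone := QTriple qone_subproof.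

Fact qemb_subproof a :
  quotient_maps setT (fun x => (x * a)%g) (fun y => (a * y)%g).
Proof.
split=> *; rewrite ?rng_mulDl ?rng_mulDr ?mulgA //.
exact: nonzero_idealT.
Qed.
Definition qemb a := QTriple (qemb_subproof a).

Fact qopp_subproof p :
  quotient_maps (qdom p) (fun x => - qleft p x) (fun y => - qright p y).
Proof.
split=> *; first exact: qdomP.
- by rewrite qleftD // opprD.
- by rewrite qleftM // rng_mulrN.
- by rewrite qrightD // opprD.
- by rewrite qrightM // rng_mulNr.
- by rewrite rng_mulNr rng_mulrN qleft_right.
Qed.
Definition qopp p := QTriple (qopp_subproof p).

Fact qadd_subproof p q : quotient_maps (qdom p `&` qdom q)
  (fun x => qleft p x + qleft q x) (fun y => qright p y + qright q y).
Proof.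
split; first exact: nonzero_idealI (qdomP p) (qdomP q).
- by move=> x y [? ?] [? ?]; rewrite !qleftD // addrACA.
- by move=> r x [? ?]; rewrite !qleftM // rng_mulDr.
- by move=> x y [? ?] [? ?]; rewrite !qrightD // addrACA.
- by move=> x r [? ?]; rewrite !qrightM // rng_mulDl.
- by move=> x y [? ?] [? ?]; rewrite rng_mulDl rng_mulDr !qleft_right.
Qed.
Definition qadd p q := QTriple (qadd_subproof p q).

Lemma qleft0 p : qleft p 0 = 0.
Proof.
have [[[p0 _] _] _] := qdomP p.
by apply: (addrI (qleft p 0)); rewrite -qleftD // !addr0.
Qed.

Lemma qright0 p : qright p 0 = 0.
Proof.
have [[[p0 _] _] _] := qdomP p.
by apply: (addrI (qright p 0)); rewrite -qrightD // !addr0.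
Qed.

Lemma qleftN p x : qdom p x -> qleft p (- x) = - qleft p x.
Proof.
move=> px; have [[sp _] _] := qdomP p.
apply: (addrI (qleft p x)); rewrite -qleftD ?subrr ?qleft0 //.
exact: add_subgroupN.
Qed.

Lemma qrightN p x : qdom p x -> qright p (- x) = - qright p x.
Proof.
move=> px; have [[sp _] _] := qdomP p.
apply: (addrI (qright p x)); rewrite -qrightD ?subrr ?qright0 //.
exact: add_subgroupN.
Qed.

Local Notation idealM := (add_gen2 (fun x y : R => (x * y)%g)).

Lemma idealM_act p q I J : nonzero_ideal I -> nonzero_ideal J ->
  I `<=` qdom p -> J `<=` qdom q ->
  forall x, idealM J I x ->
    [/\ I x, J x, J (qleft p x) & I (qright q x)].
Proof.
move=> [[sI IM] _] [[sJ JM] _] Ip Jq.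
pose A := [set x | [/\ I x, J x, J (qleft p x) & I (qright q x)]].
have sA : add_subgroup A.
  split=> [|x y [Ix Jx pJx qIx] [Iy Jy pJy qIy]].
    by rewrite /A/= qleft0 qright0; case: sI sJ => ? _ [].
  split; [exact: sI.2|exact: sJ.2| |].
    rewrite qleftD ?qleftN; [exact: sJ.2|exact: Ip|exact: Ip|].
    by apply: add_subgroupN (Ip _ Iy); case: (qdomP p) => -[].
  rewrite qrightD ?qrightN; [exact: sI.2|exact: Jq|exact: Jq|].
  by apply: add_subgroupN (Jq _ Jy); case: (qdomP q) => -[].
move=> x; apply: (@add_gen_sub _ _ A) => // _ [a Ja [b Ib <-]]; split.
- exact: (IM _ _ Ib).1.
- exact: (JM _ _ Ja).2.
- by rewrite qleftM; [exact: (JM _ _ Ja).2|exact: Ip].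
- by rewrite qrightM; [exact: (IM _ _ Ib).1|exact: Jq].
Qed.

Lemma qmul_act p q x : idealM (qdom q) (qdom p) x ->
  [/\ qdom p x, qdom q x, qdom q (qleft p x) & qdom p (qright q x)].
Proof. by apply: idealM_act => //; exact: qdomP. Qed.

Fact qmul_subproof p q : quotient_maps (idealM (qdom q) (qdom p))
  (fun x => qleft q (qleft p x)) (fun y => qright p (qright q y)).
Proof.
split; first exact: nonzero_idealM (qdomP q) (qdomP p).
- by move=> x y /qmul_act[? ? ? ?] /qmul_act[? ? ? ?]; rewrite !qleftD.
- by move=> r x /qmul_act[? ? ? ?]; rewrite !qleftM.
- by move=> x y /qmul_act[? ? ? ?] /qmul_act[? ? ? ?]; rewrite !qrightD.
- by move=> x r /qmul_act[? ? ? ?]; rewrite !qrightM.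
- move=> x y /qmul_act[? ? ? ?] /qmul_act[? ? ? ?].
  by rewrite qleft_right // qleft_right.
Qed.
(* On the ideal JI, where I and J are the domains of p and q, the maps of the
   product pq are x |-> (xp)q and y |-> p(qy). *)
Definition qmul p q := QTriple (qmul_subproof p q).

Definition Qs_zero : Qs := lift_cst Qs qzero.
Definition Qs_one : Qs := lift_cst Qs qone.
Definition Qs_opp := lift_op1 Qs qopp.
Definition Qs_add := lift_op2 Qs qadd.
Definition Qs_mul := lift_op2 Qs qmul.

Canonical pi_Qs_zero := PiConst Qs_zero.
Canonical pi_Qs_one := PiConst Qs_one.

Lemma pi_Qs_opp : {morph \pi_Qs : p / qopp p >-> Qs_opp p}.
Proof.
move=> p; unlock Qs_opp; apply/eqP/qeqP.
have /eqP/qeqP[J [nJ sJ eJ]] : p = repr (\pi_Qs p) %[mod Qs] by rewrite reprK.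
exists J; split=> // x Jx; have [] := eJ x Jx.
by rewrite /= => -> ->.
Qed.
Canonical pi_Qs_opp_morph := PiMorph1 pi_Qs_opp.

Lemma pi_Qs_add : {morph \pi_Qs : p q / qadd p q >-> Qs_add p q}.
Proof.
move=> p q; unlock Qs_add; apply/eqP/qeqP.
have /eqP/qeqP[J [nJ sJ eJ]] : p = repr (\pi_Qs p) %[mod Qs] by rewrite reprK.
have /eqP/qeqP[K [nK sK eK]] : q = repr (\pi_Qs q) %[mod Qs] by rewrite reprK.
exists (J `&` K); split; first exact: nonzero_idealI.
  by move=> x [/sJ[? ?] /sK[? ?]].
by move=> x [/eJ[/= -> ->] /eK[/= -> ->]].
Qed.
Canonical pi_Qs_add_morph := PiMorph2 pi_Qs_add.

Lemma idealM_mono (I I' J J' : set R) :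
  I `<=` I' -> J `<=` J' -> idealM I J `<=` idealM I' J'.
Proof.
move=> II' JJ'; apply: add_gen_sub; first exact: add_gen_subgroup.
move=> _ [a Ia [b Jb <-]]; apply: sub_add_gen.
by exists a; [exact: II'|exists b; [exact: JJ'|]].
Qed.

Lemma pi_Qs_mul : {morph \pi_Qs : p q / qmul p q >-> Qs_mul p q}.
Proof.
move=> p q; unlock Qs_mul; apply/eqP/qeqP.
have /eqP/qeqP[J [nJ sJ eJ]] : p = repr (\pi_Qs p) %[mod Qs] by rewrite reprK.
have /eqP/qeqP[K [nK sK eK]] : q = repr (\pi_Qs q) %[mod Qs] by rewrite reprK.
have [Jp Jp'] : J `<=` qdom p /\ J `<=` qdom (repr (\pi_Qs p)).
  by split=> x /sJ[].
have [Kq Kq'] : K `<=` qdom q /\ K `<=` qdom (repr (\pi_Qs q)).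
  by split=> x /sK[].
exists (idealM K J); split; first exact: nonzero_idealM.
  by move=> x KJx; split; exact: idealM_mono KJx.
move=> x /(idealM_act nJ nK Jp Kq) [Jx Kx Kpx Jqx] /=.
by rewrite -(eJ x Jx).1 -(eK x Kx).2 (eK _ Kpx).1 (eJ _ Jqx).2.
Qed.
Canonical pi_Qs_mul_morph := PiMorph2 pi_Qs_mul.

Fact Qs_addA : associative Qs_add.
Proof.
elim/quotW=> p; elim/quotW=> q; elim/quotW=> r; rewrite !piE.
by apply: qeq_fun => x /=; rewrite addrA.
Qed.

Fact Qs_addC : commutative Qs_add.
Proof.
elim/quotW=> p; elim/quotW=> q; rewrite !piE.
by apply: qeq_fun => x /=; rewrite addrC.
Qed.

Fact Qs_add0 : left_id Qs_zero Qs_add.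
Proof.
elim/quotW=> p; rewrite !piE.
by apply: qeq_fun => x /=; rewrite add0r.
Qed.

Fact Qs_addN : left_inverse Qs_zero Qs_opp Qs_add.
Proof.
elim/quotW=> p; rewrite !piE.
by apply: qeq_fun => x /=; rewrite addNr.
Qed.

HB.instance Definition _ :=
  GRing.isZmodule.Build Qs Qs_addA Qs_addC Qs_add0 Qs_addN.

Fact Qs_mulA : associative Qs_mul.
Proof.
by elim/quotW=> p; elim/quotW=> q; elim/quotW=> r; rewrite !piE; exact: qeq_fun.
Qed.

Fact Qs_mul1 : left_id Qs_one Qs_mul.
Proof. by elim/quotW=> p; rewrite !piE; exact: qeq_fun. Qed.

Fact Qs_mulr1 : right_id Qs_one Qs_mul.
Proof. by elim/quotW=> p; rewrite !piE; exact: qeq_fun. Qed.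

Fact Qs_mulDl : left_distributive Qs_mul Qs_add.
Proof.
elim/quotW=> p; elim/quotW=> q; elim/quotW=> r; rewrite !piE.
have nI := nonzero_idealI (qdomP (qmul (qadd p q) r))
  (qdomP (qadd (qmul p r) (qmul q r))).
apply: (qeqD_fun nI) => x [//=].
move=> _ [/qmul_act[? ? ? ?] /qmul_act[? ? ? ?]] /=.
by rewrite qleftD.
Qed.

Fact Qs_mulDr : right_distributive Qs_mul Qs_add.
Proof.
elim/quotW=> p; elim/quotW=> q; elim/quotW=> r; rewrite !piE.
have nI := nonzero_idealI (qdomP (qmul p (qadd q r)))
  (qdomP (qadd (qmul p q) (qmul p r))).
apply: (qeqD_fun nI) => x [//=].
move=> _ [/qmul_act[? ? ? ?] /qmul_act[? ? ? ?]] /=.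
by rewrite qrightD.
Qed.

Fact Qs_oner_neq0 : Qs_one != Qs_zero.
Proof.
rewrite /Qs_one /Qs_zero; unlock; apply/negP => /qeqP eqJ.
by have [J [[_ [x Jx x0]] _ /(_ x Jx)[/= /x0]]] := eqJ.
Qed.

HB.instance Definition _ := GRing.Zmodule_isNzRing.Build Qs
  Qs_mulA Qs_mul1 Qs_mulr1 Qs_mulDl Qs_mulDr Qs_oner_neq0.

End Quotients.

Section ExtendedCentroid.
Variable R : primeRngType.

Definition toQs (a : R) : Qs R := \pi_(Qs R) (qemb a).

Lemma toQsD a b : toQs (a + b) = toQs a + toQs b.
Proof.
apply: etrans (pi_Qs_add _ _); apply: qeq_fun => x /=.
  by rewrite rng_mulDr.
by rewrite rng_mulDl.
Qed.

Lemma toQsM a b : toQs (a * b)%g = toQs a * toQs b.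
Proof.
apply: etrans (pi_Qs_mul _ _); apply: qeq_fun => x /=; first by rewrite mulgA.
by rewrite mulgA.
Qed.

Lemma toQs_inj : injective toQs.
Proof.
move=> a b /eqP/qeqP[J [[[_ JM] [x Jx x0]] _ eJ]]; apply/eqP; rewrite -subr_eq0.
apply/eqP; suff /prime_rng_prime[//|/x0[]] :
  forall r, ((a - b) * r * x)%g = 0.
move=> r.
have [rJ _] := JM x r Jx.
have /= [_ e] := eJ _ rJ.
by rewrite -mulgA rng_mulDl rng_mulNr e subrr.
Qed.

Definition extended_centroid : set (Qs R) :=
  [set c | forall q : Qs R, c * q = q * c].

(* RC, as a subset of the symmetric ring of quotients. *)
Definition central_closure : set (Qs R) :=
  add_gen2 (fun p q : Qs R => p * q) (range toQs) extended_centroid.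

Definition Qs_bracket (p q : Qs R) : Qs R := p * q - q * p.

(* W, a C-subspace of the ring of quotients, has a C-basis with n elements. *)
Definition has_Cdim (W : set (Qs R)) (n : nat) : Prop :=
  exists v : 'I_n -> Qs R, (forall i, W (v i)) /\
    forall q, W q -> exists! c : {ffun 'I_n -> Qs R},
      (forall i, extended_centroid (c i)) /\ q = \sum_(i < n) c i * v i.

(* As R is nonzero, "char R = 2" means 2R = 0. *)
Definition exceptional : Prop :=
  (forall x : R, x *+ 2 = 0) /\ has_Cdim central_closure 4.

End ExtendedCentroid.

Arguments extended_centroid R : clear implicits.
Arguments central_closure R : clear implicits.

(* Main.v *)
Require Import Defs.
From mathcomp Require Import all_boot all_order all_algebra.
From mathcomp Require Import all_classical.

(* Write d_a for the derivation [a, -], and call a noncentral u quadratic if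
   [u, R] is contained in C + Cu.

   If E_m(L)^+ and E_k(L)^+ commute, then E_n(L)^+ is abelian for n = max(m, k),
   since these Lie ideals decrease.  Hence there are noncentral Lie ideals U and
   V with [U, V] central: both are E_n(L)^+, or E_j(L)^+ and L for some j.
   Expanding d_v d_u on products (u in U, v in V), and using that nonzero a, b'
   with a y b = a' y b' for all y satisfy a' = c a for a scalar c in C
   (Martindale), shows that char R = 2 and that U contains a quadratic u.
   Rescaling gives x in RC with [u, x] = 1; then u^2 and x^2 are in C, and
   a = [u, xa] - x[u, a] shows that 1, u, x, ux is a basis of RC, while [RC, RC]
   is the span of 1, u, x.  Finally l in L satisfies d_l^2 = c d_l, where the
   scalar c is the coefficient of ux.  If c <> 0, then [l, R] is contained in
   C E_n(L)^+, hence is abelian, which forces l to be central.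

   Conversely, suppose that char R = 2 and dim RC = 4.  A derivation d_a with a
   noncentral has rank at least 2, so any three elements of RC commuting with a
   are dependent.  This yields first 1 in RC, then that the square of every
   commutator is in C, so that a noncentral commutator is quadratic.  The basis
   above is therefore available, and [L, L] is central if L is contained in
   [RC, RC]. *)

Set Implicit Arguments.
Unset Strict Implicit.
Unset Printing Implicit Defensive.

Import GRing.Theory.
Local Open Scope classical_set_scope.
Local Open Scope ring_scope.
Local Open Scope quotient_scope.

(** * The symmetric ring of quotients *)

Section SymmetricQuotients.
Context {R : primeRngType}.
Local Notation Q := (Qs R).
Local Notation iota := (@toQs R).
Local Notation C := (extended_centroid R).
Implicit Types (a b r x y : R) (I : set R) (p q c : Q).

Lemma toQs0 : iota 0 = 0.
Proof. by apply: (addrI (iota 0)); rewrite -toQsD !addr0. Qed.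

Lemma toQsN a : iota (- a) = - iota a.
Proof. by apply: (addrI (iota a)); rewrite -toQsD !subrr toQs0. Qed.

Lemma toQsB a b : iota (a - b) = iota a - iota b.
Proof. by rewrite toQsD toQsN. Qed.

Lemma toQs_bracket a b :
  iota (rng_bracket a b) = Qs_bracket (iota a) (iota b).
Proof. by rewrite toQsB !toQsM. Qed.

Lemma toQs_eq0 a : iota a = 0 -> a = 0.
Proof. by rewrite -toQs0 => /toQs_inj. Qed.

Lemma toQs_mul_pi (t : qtriple R) x : qdom t x ->
  iota x * \pi_Q t = iota (qleft t x) /\ \pi_Q t * iota x = iota (qright t x).
Proof.
move=> tx; split.
- apply: etrans (esym (pi_Qs_mul _ _)) _.
  have nJ := nonzero_idealI (qdomP (qmul (qemb x) t)) (qdomP t).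
  apply: (qeqD_fun nJ) => [y []//|//|y [_ ty]] /=.
  by rewrite qleftM // qleft_right.
- apply: etrans (esym (pi_Qs_mul _ _)) _.
  have nJ := nonzero_idealI (qdomP (qmul t (qemb x))) (qdomP t).
  apply: (qeqD_fun nJ) => [y []//|//|y [_ ty]] /=.
  by rewrite qrightM // -qleft_right.
Qed.

Lemma Qs_dom q : exists2 I, nonzero_ideal I & forall x, I x ->
  (exists a, iota x * q = iota a) /\ (exists a, q * iota x = iota a).
Proof.
elim/quotW: q => t; exists (qdom t); first exact: qdomP.
by move=> x /toQs_mul_pi[-> ->]; split; eexists.
Qed.

Lemma ideal_annihilator I a : nonzero_ideal I ->
  (forall x, I x -> (x * a)%g = 0) \/ (forall x, I x -> (a * x)%g = 0) ->
  a = 0.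
Proof.
move=> [[_ IM] [x Ix x0]] aI.
suff : x = 0 \/ a = 0 by case.
case: aI => aI.
  by apply: prime_rng_prime => r; apply: aI; exact: (IM _ _ Ix).2.
apply/or_comm; apply: prime_rng_prime => r.
by rewrite -mulgA; apply: aI; exact: (IM _ _ Ix).1.
Qed.

(** On a common ideal one of the two maps representing [q] vanishes; the relation
    [f x * y = x * g y] and [ideal_annihilator] then make the other one vanish too. *)
Lemma Qs_annihilator I q : nonzero_ideal I ->
  (forall x, I x -> iota x * q = 0) \/ (forall x, I x -> q * iota x = 0) ->
  q = 0.
Proof.
elim/quotW: q => t nI qI.
have nJ := nonzero_idealI nI (qdomP t).
suff tJ x : I x /\ qdom t x -> qleft t x = 0 /\ qright t x = 0.
  apply: etrans (_ : \pi_Q (qzero R) = 0); last by rewrite piE.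
  by apply: (qeqD_fun nJ) => [x []//|//|x /tJ[-> ->]].
move=> Jx; case: qI => qI.
  have l0 y : I y /\ qdom t y -> qleft t y = 0.
    by case=> Iy ty; apply: toQs_eq0; rewrite -(toQs_mul_pi ty).1 qI.
  split; first exact: l0.
  apply: (ideal_annihilator nJ); left=> y Jy.
  by rewrite -qleft_right ?l0 ?rng_mul0r //; [case: Jy|case: Jx].
have r0 y : I y /\ qdom t y -> qright t y = 0.
  by case=> Iy ty; apply: toQs_eq0; rewrite -(toQs_mul_pi ty).2 qI.
split; last exact: r0.
apply: (ideal_annihilator nJ); right=> y Jy.
by rewrite qleft_right ?r0 ?rng_mulr0 //; [case: Jx|case: Jy].
Qed.

(** If [p] and [q] are nonzero, then so are suitable multiples [x p] and [q y] lying in [R], to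
    which the primeness of [R] applies. *)
Lemma Qs_prime p q : (forall r, p * iota r * q = 0) -> p = 0 \/ q = 0.
Proof.
move=> pq; have [I nI Ip] := Qs_dom p; have [J nJ Jq] := Qs_dom q.
have [p0|p0] := pselect (p = 0); [by left|right].
apply: (Qs_annihilator nJ); right=> y Jy.
apply: contrapT => qy0; apply: p0; apply: (Qs_annihilator nI); left=> x Ix.
have [[a xa] _] := Ip x Ix; have [_ [b yb]] := Jq y Jy.
rewrite xa; rewrite yb in qy0.
suff : a = 0 \/ b = 0 by case=> e; [rewrite e toQs0|rewrite e toQs0 in qy0].
apply: prime_rng_prime => r; apply: toQs_inj.
rewrite !toQsM toQs0 -xa -yb.
by rewrite -!mulrA (mulrA p) (mulrA (p * _)) pq !(mul0r, mulr0).
Qed.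

Lemma extended_centroidP c :
  (forall r, c * iota r = iota r * c) -> C c.
Proof.
move=> cR p; have [I nI Ip] := Qs_dom p.
apply/eqP; rewrite -subr_eq0; apply/eqP.
apply: (Qs_annihilator nI); left=> x Ix; have [[a xa] _] := Ip x Ix.
by rewrite mulrBr mulrA -cR -mulrA xa mulrA xa cR subrr.
Qed.

(* Every [s] such that [s y b = t y b'] for all [y] and some (unique) [t] is
   sent to this [t]; this bimodule map, defined on a nonzero ideal, is the
   scalar. *)
Lemma martindale a a' b b' : a <> 0 -> b' <> 0 ->
  (forall y, (a * y * b)%g = (a' * y * b')%g) ->
  exists2 c, C c & iota a' = c * iota a.
Proof.
move=> a0 b0 ab.
pose G (s t : R) := forall y, (s * y * b)%g = (t * y * b')%g.
have GD (s t s' t' : R) : G s t -> G s' t' -> G (s + s') (t + t').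
  by move=> st st' y; rewrite !rng_mulDl st st'.
have GN (s t : R) : G s t -> G (- s) (- t).
  by move=> st y; rewrite !rng_mulNr st.
have Gl (r s t : R) : G s t -> G (r * s)%g (r * t)%g.
  by move=> st y; rewrite -!mulgA !(mulgA _ y) st.
have Gr (r s t : R) : G s t -> G (s * r)%g (t * r)%g.
  by move=> st y; rewrite -!(mulgA _ r) st.
have G0 : G 0 0 by move=> y; rewrite !rng_mul0r.
have Gu (s t t' : R) : G s t -> G s t' -> t = t'.
  move=> st st'; apply/eqP; rewrite -subr_eq0; apply/eqP.
  suff /prime_rng_prime[|/b0] : forall y, ((t - t') * y * b')%g = 0 by [].
  by move=> y; rewrite !rng_mulDl !rng_mulNr -st -st' subrr.
pose I := [set s : R | exists t : R, G s t].
have /choice[f fP] : forall s : R, exists t : R, I s -> G s t.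
  by move=> s; have [[t st]|nI] := pselect (I s); [exists t|exists 0].
have fE (s t : R) : G s t -> f s = t.
  by move=> st; apply: (Gu s _ _ (fP s _) st); exists t.
have fI : quotient_maps I f f.
  split.
  - split; last by exists a => //; exists a'.
    split; first split; first by exists 0.
      by move=> x y [s xp] [t yq]; exists (s - t); apply: GD => //; exact: GN.
    by move=> x r [t xq]; split; eexists; [exact: Gl xq|exact: Gr xq].
  - by move=> x y /fP Gx /fP Gy; apply: fE; exact: GD.
  - by move=> r x /fP Gx; apply: fE; exact: Gl.
  - by move=> x y /fP Gx /fP Gy; apply: fE; exact: GD.
  - by move=> x r /fP Gx; apply: fE; exact: Gr.
  - by move=> x y /fP Gx /fP Gy; exact: (Gu _ _ _ (Gr _ _ _ Gx) (Gl _ _ _ Gy)).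
pose c := \pi_Q (QTriple fI).
have cE x : I x -> c * iota x = iota (f x).
  by move=> Ix; case: (@toQs_mul_pi (QTriple fI) x Ix).
have Ia : I a by exists a'.
exists c; last by rewrite cE // (fE a a').
apply: extended_centroidP => r.
apply/eqP; rewrite -subr_eq0; apply/eqP.
apply: (Qs_annihilator (qm_ideal fI)); right=> x Ix.
rewrite mulrBl -!mulrA -toQsM !cE //; last first.
  by have [t xq] := Ix; eexists; exact: Gl xq.
by rewrite (fE _ _ (Gl r _ _ (fP _ Ix))) toQsM subrr.
Qed.

End SymmetricQuotients.

(** * Inner derivations *)

Section Brackets.
Context {R : primeRngType}.
Local Notation Q := (Qs R).
Local Notation iota := (@toQs R).
Local Notation C := (extended_centroid R).
Local Notation br := (@Qs_bracket R).
Implicit Types (x y z : R) (p q r c : Q).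

Lemma brDl p q r : br (p + q) r = br p r + br q r.
Proof. by rewrite /Qs_bracket mulrDl mulrDr opprD addrACA. Qed.

Lemma brDr p q r : br p (q + r) = br p q + br p r.
Proof. by rewrite /Qs_bracket mulrDl mulrDr opprD addrACA. Qed.

Lemma brN p q : br q p = - br p q.
Proof. by rewrite /Qs_bracket opprB. Qed.

Lemma brNr p q : br p (- q) = - br p q.
Proof. by rewrite /Qs_bracket mulrN mulNr -opprD. Qed.

Lemma brBr p q r : br p (q - r) = br p q - br p r.
Proof. by rewrite brDr brNr. Qed.

Lemma brBl p q r : br (p - q) r = br p r - br q r.
Proof. by rewrite !(brN r) brBr opprD opprK. Qed.

Lemma brMr p q r : br p (q * r) = br p q * r + q * br p r.
Proof.
by rewrite /Qs_bracket mulrBl mulrBr !mulrA addrA subrK.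
Qed.

Lemma brMl p q r : br (p * q) r = p * br q r + br p r * q.
Proof. by rewrite brN brMr opprD -mulNr -mulrN -!brN addrC. Qed.

Lemma br_jacobi p q r : br (br p q) r = br (br p r) q + br p (br q r).
Proof.
rewrite [X in br X r]/Qs_bracket brBl !brMl.
move: (br p r) (br q r) => s t; rewrite /Qs_bracket opprD !addrA.
by rewrite [LHS](ACl (2*3*1*4)).
Qed.

Lemma brr p : br p p = 0.
Proof. exact: subrr. Qed.

Lemma br0r p : br p 0 = 0.
Proof. by rewrite /Qs_bracket mul0r mulr0 subrr. Qed.

Lemma br0l p : br 0 p = 0.
Proof. by rewrite brN br0r oppr0. Qed.

Lemma br_eq0 p q : br p q = 0 -> p * q = q * p.
Proof. by move/eqP; rewrite subr_eq0 => /eqP. Qed.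

Lemma brCl c q : C c -> br c q = 0.
Proof. by move=> cC; rewrite /Qs_bracket cC subrr. Qed.

Lemma brCr c q : C c -> br q c = 0.
Proof. by move=> cC; rewrite brN brCl ?oppr0. Qed.

Lemma brZr c p q : C c -> br p (c * q) = c * br p q.
Proof. by move=> cC; rewrite brMr (brCr _ cC) mul0r add0r. Qed.

Lemma brZl c p q : C c -> br (c * p) q = c * br p q.
Proof. by move=> cC; rewrite brMl (brCl _ cC) mul0r addr0. Qed.

Lemma mulrCA_C c p q : C c -> p * (c * q) = c * (p * q).
Proof. by move=> cC; rewrite mulrA -cC mulrA. Qed.

Lemma centroid0 : C 0. Proof. by move=> q; rewrite mul0r mulr0. Qed.

Lemma centroid1 : C 1. Proof. by move=> q; rewrite mul1r mulr1. Qed.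

Lemma centroidD c c' : C c -> C c' -> C (c + c').
Proof. by move=> cC c'C q; rewrite mulrDl mulrDr cC c'C. Qed.

Lemma centroidN c : C c -> C (- c).
Proof. by move=> cC q; rewrite mulNr mulrN cC. Qed.

Lemma centroidB c c' : C c -> C c' -> C (c - c').
Proof. by move=> cC c'C; apply: centroidD => //; apply: centroidN. Qed.

Lemma centroidM c c' : C c -> C c' -> C (c * c').
Proof. by move=> cC c'C q; rewrite -mulrA c'C (mulrCA_C _ _ cC). Qed.

Lemma centroidX c n : C c -> C (c ^+ n).
Proof.
by move=> cC; elim: n => [|n IHn]; rewrite ?exprS;
  [exact: centroid1|exact: centroidM].
Qed.

Lemma extended_centroid_reg c q : C c -> c * q = 0 -> c = 0 \/ q = 0.
Proof.
by move=> cC cq; apply: Qs_prime => r;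
  rewrite -mulrA -(mulrCA_C _ _ cC) cq mulr0.
Qed.

Lemma extended_centroid_inv c : C c -> c <> 0 ->
  exists c', [/\ C c', c' * c = 1 & c' <> 0].
Proof.
move=> cC c0; have [I nI Ic] := Qs_dom c; have [_ [x Ix x0]] := nI.
have [[b cx] _] := Ic x Ix; rewrite -cC in cx.
have b0 : b <> 0.
  move=> b0; rewrite b0 toQs0 in cx.
  by have [|/toQs_eq0] := extended_centroid_reg cC cx.
(* As [b = c x], both [b y x] and [x y b] equal [c x y x]; the resulting scalar [c'] with [x = c' b]
   is the inverse of [c]. *)
have [|c' c'C xE] := martindale (a' := x) (b := x) b0 b0.
  by move=> y; apply: toQs_inj; rewrite !toQsM -cx !mulrA -cC !mulrA.
have c'c : c' * c = 1.
  apply/eqP; rewrite -subr_eq0; apply/eqP.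
  have [//|/toQs_eq0//] : c' * c - 1 = 0 \/ iota x = 0.
    apply: extended_centroid_reg; first by apply: centroidB;
      [exact: centroidM|exact: centroid1].
    by rewrite mulrBl mul1r -mulrA cx -xE subrr.
exists c'; split=> // c'0; move/eqP: c'c.
by rewrite c'0 mul0r eq_sym oner_eq0.
Qed.

Lemma rng_center_toQs x : rng_center R x <-> C (iota x).
Proof.
split=> [xZ|xC y]; first by apply: extended_centroidP => y; rewrite -!toQsM xZ.
by apply: toQs_inj; rewrite !toQsM xC.
Qed.

Lemma br_centroid q : (forall x, br q (iota x) = 0) -> C q.
Proof. by move=> q0; apply: extended_centroidP => x; apply: br_eq0. Qed.

Lemma not_centroid q : ~ C q -> exists x, br q (iota x) <> 0.
Proof.
move=> qC; apply: contrapT => /forallNP q0; apply: qC; apply: br_centroid => x.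
by apply: contrapT; exact: q0.
Qed.

(** With [d = [u, -]] and [e = [v, -]], expanding the hypothesis on [x * y] and then replacing [y]
    by [y * z] gives [d x * y * e z + e x * y * d z = 0]. By [martindale] this makes [e = c d] for a
    scalar [c], with [e x0 = - c d x0] at a point where [d x0] is nonzero; comparing the two gives
    [2 c = 0]. *)
Lemma posner (u v : R) : ~ C (iota u) ->
  (forall x, br (br (iota u) (iota x)) (iota v) = 0) ->
  exists c, [/\ C c, C (iota v - c * iota u) & c + c = 0].
Proof.
move=> uC uv0; pose d x := br (iota u) (iota x);
  pose e x := br (iota v) (iota x).
have de x y : d x * e y + e x * d y = 0.
  have := uv0 (x * y)%g.
  rewrite toQsM brMr brDl !brMl !uv0 mul0r mulr0 addr0 add0r.
  by rewrite -/(d x) -/(d y) !(brN (iota v)) mulrN mulNr -opprD => /eqP;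
    rewrite oppr_eq0 => /eqP.
have dye x y z : d x * iota y * e z + e x * iota y * d z = 0.
  have := de x (y * z)%g;
    rewrite /d /e toQsM !brMr !mulrDr !mulrA -/(d x) -/(e x).
  by rewrite addrACA -mulrDl -/(d y) -/(e y) de mul0r add0r.
have [x0 dx0] := not_centroid uC.
pose a := rng_bracket u x0; pose b := rng_bracket v x0.
have aE : iota a = d x0 by rewrite toQs_bracket.
have bE : iota b = e x0 by rewrite toQs_bracket.
have a0 : a <> 0 by move=> a0; apply: dx0; rewrite -/(d x0) -aE a0 toQs0.
have [|c cC cE] := martindale (a' := - b) (b := b) a0 a0.
  move=> y; apply: toQs_inj; rewrite !toQsM toQsN aE bE !mulNr.
  by apply/eqP; rewrite -addr_eq0 dye.
have ecd z : e z = c * d z.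
  apply/eqP; rewrite -subr_eq0; apply/eqP.
  have [/dx0[]|//] : d x0 = 0 \/ e z - c * d z = 0.
  apply: Qs_prime => y; rewrite mulrBr (mulrCA_C _ _ cC) !mulrA -aE -cE.
  by rewrite toQsN bE aE !mulNr opprK dye.
exists c; split=> //.
  apply: br_centroid => z; rewrite brDl -mulNr brZl ?mulNr;
    last exact: centroidN.
  by rewrite -/(d z) -/(e z) ecd subrr.
have cd0 : (c + c) * d x0 = 0.
  by rewrite mulrDl -aE -[X in X + _]cE toQsN bE aE ecd addNr.
by have [|/dx0[]] := extended_centroid_reg (centroidD cC cC) cd0.
Qed.

End Brackets.

(** * Noncentral Lie ideals whose mutual brackets are central *)

Section LieIdeals.
Context {R : primeRngType}.
Local Notation Q := (Qs R).
Local Notation iota := (@toQs R).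
Local Notation C := (extended_centroid R).
Local Notation br := (@Qs_bracket R).
Implicit Types (x y z : R) (p q r c : Q) (U V : set R).

Definition centroid_span q : set Q :=
  [set p | exists a b, [/\ C a, C b & p = a + b * q]].

Lemma not_sub_center U : ~ U `<=` rng_center R ->
  exists2 u, U u & ~ C (iota u).
Proof.
move=> UZ; apply: contrapT => nU; apply: UZ => u Uu; apply/rng_center_toQs.
by apply: contrapT => uC; apply: nU; exists u.
Qed.

Lemma lie_ideal_bracket U u x : lie_ideal U -> U u -> U (rng_bracket u x).
Proof.
by move=> [_ UR] Uu; apply: UR; apply: sub_add_gen; exists u => //; exists x.
Qed.

Lemma central_bracket_lie_ideals U V : lie_ideal U -> lie_ideal V ->
  ~ U `<=` rng_center R -> ~ V `<=` rng_center R ->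
  (forall u v, U u -> V v -> C (br (iota u) (iota v))) ->
  1 + 1 = 0 :> Q /\ exists u, [/\ U u, ~ C (iota u) &
    forall x, centroid_span (iota u) (br (iota u) (iota x))].
Proof.
move=> lU lV UZ VZ UV.
have [[u [v [Uu Vv uv0]]]|UV0] :=
  pselect (exists u v, [/\ U u, V v & br (iota u) (iota v) <> 0]).
  have uC : ~ C (iota u) by move=> uC; rewrite brCl in uv0.
  set z := br (iota u) (iota v) in uv0.
  have zC : C z by exact: UV.
  have [z' [z'C z'z _]] := extended_centroid_inv zC uv0.
  pose d x := br (iota u) (iota x); pose t x := br (d x) (iota v).
  have tC x : C (t x).
    by rewrite /t /d -toQs_bracket; apply: UV => //; exact: lie_ideal_bracket.
  (* This element is [[[u, u x], v]]. It and [t x] are central and [z] is invertible, so it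
     expresses [d x] in [C + C u]. *)
  have utC x : C (iota u * t x + z * d x).
    have := UV _ _ (lie_ideal_bracket (u * x)%g lU Uu) Vv.
    by rewrite toQs_bracket toQsM brMr brr mul0r add0r brMl.
  have du x : br (d x) (iota u) = 0.
    have := brCr (iota u) (utC x);
      rewrite brDr (brZr _ _ zC) brMr brr (brCr _ (tC x)).
    rewrite mul0r mulr0 !add0r => /(extended_centroid_reg zC)[//|].
    by rewrite brN => /eqP; rewrite oppr_eq0 => /eqP.
  (* Taking [v = u] gives [2 c = 0] with [(1 - c) u] central; since [u] is not central, [c = 1] and
     the characteristic is two. *)
  have [c [cC ucC cc]] := posner uC du.
  have c1 : c = 1.
    apply: contrapT => c1; have C1c : C (1 - c) by apply: centroidB => //;
      exact: centroid1.
    have [|b [bC bc _]] := extended_centroid_inv C1c.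
      by move/eqP; rewrite subr_eq0 eq_sym => /eqP.
    apply: uC; rewrite -[iota u]mul1r -bc -mulrA mulrBl mul1r; exact: centroidM.
  split; first by rewrite -c1.
  exists u; split=> // x;
    exists (z' * (iota u * t x + z * d x)), (- (z' * t x)).
  split; [exact: centroidM|apply: centroidN; exact: centroidM|].
  by rewrite mulrDr addrAC mulNr -mulrA (tC x) subrr add0r mulrA z'z mul1r.
(* Now [[U, V] = 0], so [posner] places every element of [V] in [C + C u]. The coefficient [c] of a
   noncentral [v] is nonzero, which forces characteristic two and [[u, x] = c^-1 [v, x]]; the
   bracket [[v, x]] lies in [V] again. *)
have {}UV u v : U u -> V v -> br (iota u) (iota v) = 0.
  by move=> Uu Vv; apply: contrapT => uv; apply: UV0; exists u, v.
have [u Uu uC] := not_sub_center UZ; have [v Vv vC] := not_sub_center VZ.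
have P w : V w -> exists c, [/\ C c, C (iota w - c * iota u) & c + c = 0].
  move=> Vw; apply: posner => // x.
  by rewrite -toQs_bracket; apply: UV => //; exact: lie_ideal_bracket.
have [c [cC vuC cc]] := P v Vv.
have c0 : c <> 0 by move=> c0; apply: vC; rewrite c0 mul0r subr0 in vuC.
have [c' [c'C c'c _]] := extended_centroid_inv cC c0.
split; first by rewrite -c'c -mulrDr cc mulr0.
exists u; split=> // x; have [b [bC wC _]] := P _ (lie_ideal_bracket x lV Vv).
move: wC; rewrite toQs_bracket; set w := _ - _ => wC.
have -> : br (iota u) (iota x) = c' * br (iota v) (iota x).
  rewrite -[iota v](subrK (c * iota u)) brDl (brCl _ vuC) add0r (brZl _ _ cC).
  by rewrite mulrA c'c mul1r.
exists (c' * w), (c' * b); split; [exact: centroidM|exact: centroidM|].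
by rewrite -mulrA -mulrDr subrK.
Qed.

End LieIdeals.

(** * The central closure in characteristic two *)

Section CentralClosure.
Context {R : primeRngType}.
Local Notation Q := (Qs R).
Local Notation iota := (@toQs R).
Local Notation C := (extended_centroid R).
Local Notation A := (central_closure R).
Local Notation br := (@Qs_bracket R).
Implicit Types (p q r a b c : Q).

Lemma closure_subgroup : add_subgroup A. Proof. exact: add_gen_subgroup. Qed.

Lemma closure0 : A 0. Proof. by case: closure_subgroup. Qed.

Lemma closureB a b : A a -> A b -> A (a - b).
Proof. by case: closure_subgroup => _; exact. Qed.

Lemma closureD a b : A a -> A b -> A (a + b).
Proof. exact: add_subgroupD closure_subgroup. Qed.

Lemma closure_toQs x : A (iota x).
Proof.
by apply: sub_add_gen; exists (iota x) => //; exists 1; rewrite ?mulr1 //;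
  exact: centroid1.
Qed.

Lemma closure_ind (P : set Q) : add_subgroup P ->
  (forall x c, C c -> P (c * iota x)) -> A `<=` P.
Proof.
move=> sP PZ; apply: add_gen_sub => // _ [_ [x _ <-] [c cC <-]].
by rewrite -cC; exact: PZ.
Qed.

Lemma closureZ c a : C c -> A a -> A (c * a).
Proof.
move=> cC; apply: (closure_ind (P := [set a | A (c * a)])).
  split=> [|x y Ax Ay]; first by rewrite /= mulr0; exact: closure0.
  by rewrite /= mulrBr; exact: closureB.
move=> x d dC /=; rewrite mulrA (centroidM cC dC).
by apply: sub_add_gen; exists (iota x) => //; exists (c * d) => //;
  exact: centroidM.
Qed.

Lemma closureM a b : A a -> A b -> A (a * b).
Proof.
move=> Aa Ab; move: a Aa; apply: (closure_ind (P := [set a | A (a * b)])).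
  split=> [|x y Ax Ay]; first by rewrite /= mul0r; exact: closure0.
  by rewrite /= mulrBl; exact: closureB.
move=> x c cC; rewrite /= -mulrA; apply: closureZ => //.
move: b Ab; apply: (closure_ind (P := [set b | A (iota x * b)])).
  split=> [|y z Ay Az]; first by rewrite /= mulr0; exact: closure0.
  by rewrite /= mulrBr; exact: closureB.
by move=> y d dC; rewrite /= (mulrCA_C _ _ dC) -toQsM; apply: closureZ => //;
  exact: closure_toQs.
Qed.

Lemma closure_br a b : A a -> A b -> A (br a b).
Proof. by move=> Aa Ab; apply: closureB; exact: closureM. Qed.

Lemma closure_prime p q : (forall a, A a -> p * a * q = 0) -> p = 0 \/ q = 0.
Proof. by move=> pq; apply: Qs_prime => x; apply: pq; exact: closure_toQs. Qed.

Lemma closure_centralizer q : (forall a, A a -> br q a = 0) -> C q.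
Proof.
by move=> q0; apply: br_centroid => x; apply: q0; exact: closure_toQs.
Qed.

Lemma not_centroid_closure q : ~ C q -> exists2 a, A a & br q a <> 0.
Proof.
by case/not_centroid=> x; exists (iota x) => //; exact: closure_toQs.
Qed.

Lemma centroid_span_subgroup q : add_subgroup (centroid_span q).
Proof.
split=> [|_ _ [a [b [aC bC ->]]] [a' [b' [aC' bC' ->]]]].
  by exists 0, 0; split;
    [exact: centroid0|exact: centroid0|rewrite mul0r addr0].
exists (a - a'), (b - b'); split; [exact: centroidB|exact: centroidB|].
by rewrite mulrBl opprD addrACA.
Qed.

Lemma centroid_spanZ q c p :
  C c -> centroid_span q p -> centroid_span q (c * p).
Proof.
move=> cC [a [b [aC bC ->]]]; exists (c * a), (c * b).
by rewrite mulrDr mulrA; split=> //; exact: centroidM.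
Qed.

Lemma centroid_span_br q : (forall x, centroid_span q (br q (iota x))) ->
  forall a, A a -> centroid_span q (br q a).
Proof.
move=> qR; apply: (closure_ind (P := [set a | centroid_span q (br q a)])).
  have [S0 SB] := centroid_span_subgroup q.
  split=> [|a b Sa Sb]; first by rewrite /= br0r.
  by rewrite /= brBr; exact: SB.
by move=> x c cC; rewrite /= brZr //; exact: centroid_spanZ.
Qed.

Lemma br_centroid_span q p : centroid_span q p -> br q p = 0.
Proof.
by move=> [a [b [aC bC ->]]]; rewrite brDr brCr // brZr // brr mulr0 addr0.
Qed.

Section CharacteristicTwo.
Context (two0 : 1 + 1 = 0 :> Q).

Lemma Qs_addrr2 q : q + q = 0.
Proof. by rewrite -[q]mul1r -mulrDl two0 mul0r. Qed.

Lemma Qs_oppr2 q : - q = q.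
Proof. by apply/esym/eqP; rewrite -addr_eq0 Qs_addrr2. Qed.

Lemma sqrqD p q : (p + q) * (p + q) = p * p + q * q + br p q.
Proof.
by rewrite /Qs_bracket Qs_oppr2 mulrDl !mulrDr [LHS](AC (2*2) (1*4*(2*3))).
Qed.

(** In characteristic two the cross terms [p q p] cancel, so the square of an inner derivation is
    inner. *)
Lemma br_br p q : br p (br p q) = br (p * p) q.
Proof. by rewrite brMl [LHS]/Qs_bracket Qs_oppr2. Qed.

(** In characteristic two this presents a quaternion algebra by generators with scalar squares and
    [u x + x u = 1]. Independence of [1], [u], [x], [u x] is derived in [quat_free]. *)
Record quaternion_pair (u x : Q) : Prop := QuaternionPair {
  quatAl : A u;
  quatAr : A x;
  quat_sql : C (u * u);
  quat_sqr : C (x * x);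
  quat_br : br u x = 1;
  quat_span : forall a, A a -> exists c0 c1 c2 c3,
    [/\ C c0, C c1, C c2 & C c3] /\ a = c0 + c1 * u + c2 * x + c3 * (u * x)
}.

Lemma sqr_centroid u : (forall a, A a -> br u (br u a) = 0) -> C (u * u).
Proof.
by move=> uu; apply: closure_centralizer => a Aa; rewrite -br_br uu.
Qed.

Lemma centroid_span_sq u p : C (u * u) -> centroid_span u p -> C (p * p).
Proof.
move=> uuC [a [b [aC bC ->]]]; rewrite sqrqD brCl // addr0.
apply: centroidD; first exact: centroidM.
by rewrite -mulrA (mulrCA_C _ _ bC); do 2!apply: centroidM => //.
Qed.

(* Otherwise [u] has a translate [n] by a scalar such that [n * n = 0] and
   [br n b] is in [C n] for all [b], whence [n * b * n = n * br n b = 0]. *)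
Lemma br_span_not_nil u : A u -> ~ C u ->
  (forall a, A a -> centroid_span u (br u a)) ->
  exists2 a, A a & br u a * br u a <> 0.
Proof.
move=> Au uC uA; apply: contrapT => nil.
have {}nil a : A a -> br u a * br u a = 0.
  by move=> Aa; apply: contrapT => w0; apply: nil; exists a.
have [a Aa w0] := not_centroid_closure uC.
have [f [e [fC eC wE]]] := uA a Aa.
have e0 : e <> 0.
  move=> e0; move: (nil a Aa) w0; rewrite wE e0 mul0r addr0.
  by move=> /(extended_centroid_reg fC)[].
have [e' [e'C e'e _]] := extended_centroid_inv eC e0.
pose n := e' * f + u.
have nE : n = e' * br u a by rewrite wE mulrDr mulrA e'e mul1r.
have nn : n * n = 0 by rewrite {2}nE (mulrCA_C _ _ e'C) nE -mulrA nil // !mulr0.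
have ne : br u a = e * n by rewrite nE mulrA -e'C e'e mul1r.
have fC' : C (e' * f) by exact: centroidM.
suff nA b : A b -> n * b * n = 0.
  by have [] := closure_prime nA; move=> n0; apply: w0; rewrite ne n0 mulr0.
move=> Ab; have [f1 [e1 [f1C e1C]]] := uA b Ab.
pose g := f1 - e1 * (e' * f); have gC : C g by apply: centroidB => //;
  exact: centroidM.
have -> : f1 = g + e1 * (e' * f) by rewrite subrK.
rewrite -addrA -mulrDr -/n => bE.
have : br u b * br u b = 0 by exact: nil.
rewrite bE sqrqD brCl // addr0 -mulrA (mulrCA_C _ _ e1C) nn !mulr0 addr0.
move=> gg0; have g0 : g = 0 by case: (extended_centroid_reg gC gg0).
have nb : br n b = e1 * n by rewrite brDl brCl // add0r bE g0 add0r.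
have : n * br n b = 0 by rewrite nb (mulrCA_C _ _ e1C) nn mulr0.
by rewrite /Qs_bracket mulrBr mulrA nn mul0r sub0r mulrA => /eqP;
  rewrite oppr_eq0 => /eqP.
Qed.

Lemma quaternion_pair_of_span u : A u -> ~ C u ->
  (forall a, A a -> centroid_span u (br u a)) -> exists x, quaternion_pair u x.
Proof.
move=> Au uC uA.
have uuC : C (u * u) by apply: sqr_centroid => // a Aa;
  exact: br_centroid_span (uA a Aa).
have [y Ay w0] := br_span_not_nil Au uC uA.
set w := br u y in w0; have Aw : A w by exact: closure_br.
have wwC : C (w * w) by exact: centroid_span_sq (uA y Ay).
have [k [kC kww _]] := extended_centroid_inv wwC w0.
(* Since [u] commutes with [w] and [k] inverts [w * w], this choice gives [[u, x] = k w [u, y] =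
   1]. *)
pose x := k * (w * y).
have Ax : A x by apply: closureZ => //; exact: closureM.
have ux : br u x = 1.
  by rewrite brZr // brMr (br_centroid_span (uA y Ay)) mul0r add0r.
have xu : x * u = u * x - 1 by rewrite -ux /Qs_bracket opprB addrC subrK.
have aE a : br u (x * a) - x * br u a = a by rewrite brMr ux mul1r addrK.
exists x; split=> //.
(* As [u] commutes with [x * x], the identity [aE] places [x * x] in [C + C u]; commuting with [x]
   then kills the coefficient of [u]. *)
- have : br u (x * x) = 0 by rewrite brMr ux mul1r mulr1 Qs_addrr2.
  move=> uxx; have := aE (x * x); rewrite uxx mulr0 subr0.
  have [b [c [bC cC ->]]] := uA _ (closureM Ax (closureM Ax Ax)) => xxE.
  have : br (x * x) x = 0 by rewrite brMl brr mulr0 mul0r addr0.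
  rewrite -xxE brDl brCl // add0r brZl // ux mulr1 => ->.
  by rewrite mul0r addr0.
- move=> a Aa; rewrite -{1}(aE a).
  have [b [c [bC cC ->]]] := uA _ (closureM Ax Aa).
  have [b' [c' [b'C c'C ->]]] := uA _ Aa.
  exists (b + c'), c, (- b'), (- c'); split.
    by split=> //; [exact: centroidD|exact: centroidN|exact: centroidN].
  rewrite mulrDr -b'C (mulrCA_C _ _ c'C) xu mulrBr mulr1 !mulNr !opprD opprK.
  by rewrite !addrA [LHS](ACl (1*5*2*3*4)).
Qed.

End CharacteristicTwo.
End CentralClosure.

(** * The quaternion basis, trace and commutators *)

Section Quaternions.
Context {R : primeRngType}.
Local Notation Q := (Qs R).
Local Notation iota := (@toQs R).
Local Notation C := (extended_centroid R).
Local Notation A := (central_closure R).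
Local Notation br := (@Qs_bracket R).
Local Notation AA := (add_gen2 br A A).
Context (two0 : 1 + 1 = 0 :> Q) (u x : Q) (ux : quaternion_pair u x).
Implicit Types (p q r a b c : Q).

Let Au : A u := quatAl ux.
Let Ax : A x := quatAr ux.
Let brux : br u x = 1 := quat_br ux.
Let brxu : br x u = 1. Proof. by rewrite brN brux Qs_oppr2. Qed.
Let A1 : A 1. Proof. by rewrite -brux; exact: closure_br. Qed.
Let Aux : A (u * x). Proof. exact: closureM. Qed.
Let br_u_ux : br u (u * x) = u.
Proof. by rewrite brMr brr brux mul0r mulr1 add0r. Qed.
Let br_x_ux : br x (u * x) = x.
Proof. by rewrite brMr brr brxu mulr0 mul1r addr0. Qed.

Let br_ux_u : br (u * x) u = u. Proof. by rewrite brN br_u_ux Qs_oppr2. Qed.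
Let br_ux_x : br (u * x) x = x. Proof. by rewrite brN br_x_ux Qs_oppr2. Qed.

(** Applying [[u, -]] leaves [c2 + c3 u], and then [[x, -]] isolates [c3]; once [c2] and [c3] are
    gone, [[x, -]] isolates [c1]. *)
Lemma quat_free c0 c1 c2 c3 : C c0 -> C c1 -> C c2 -> C c3 ->
  c0 + c1 * u + c2 * x + c3 * (u * x) = 0 ->
  [/\ c0 = 0, c1 = 0, c2 = 0 & c3 = 0].
Proof.
move=> C0 C1 C2 C3 e0.
have e1 : c2 + c3 * u = 0.
  rewrite -(br0r u) -e0 !brDr (brCr _ C0) (brZr _ _ C1) (brZr _ _ C2).
  by rewrite (brZr _ _ C3) brr brux br_u_ux mulr0 !add0r mulr1.
have c3_0 : c3 = 0.
  by rewrite -(br0r x) -e1 brDr (brCr _ C2) (brZr _ _ C3) brxu mulr1 add0r.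
have c2_0 : c2 = 0 by rewrite -e1 c3_0 mul0r addr0.
move: e0; rewrite c2_0 c3_0 !mul0r !addr0 => e0.
have c1_0 : c1 = 0.
  by rewrite -(br0r x) -e0 brDr (brCr _ C0) (brZr _ _ C1) brxu mulr1 add0r.
by move: e0; rewrite c1_0 mul0r addr0.
Qed.

Lemma quat_Cdim : has_Cdim A 4.
Proof.
pose e := [:: 1; u; x; u * x].
have sumE (c : 'I_4 -> Q) : \sum_(i < 4) c i * e`_i =
    c 0 + c 1 * u + c 2%:R * x + c 3%:R * (u * x).
  rewrite !big_ord_recl big_ord0 /= mulr1 addr0 !addrA.
  by congr (c _ + c _ * _ + c _ * _ + c _ * _); apply/val_inj.
exists (fun i => e`_i); split.
  by case=> [[|[|[|[|//]]]] i4].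
move=> a Aa; have [c0 [c1 [c2 [c3 [[C0 C1 C2 C3] aE]]]]] := quat_span ux Aa.
exists [ffun i : 'I_4 => [:: c0; c1; c2; c3]`_i]; split.
  split; first by case=> [[|[|[|[|//]]]] i4]; rewrite ffunE.
  by rewrite sumE !ffunE.
move=> c [cC]; rewrite sumE {1}aE => /eqP; rewrite -subr_eq0 => /eqP e0.
have [] := @quat_free (c0 - c 0) (c1 - c 1) (c2 - c 2%:R) (c3 - c 3%:R);
  [exact: centroidB..| |].
  by rewrite -e0 !mulrBl !opprD !addrA [LHS](ACl (1*3*5*7*2*4*6*8)).
move=> /eqP e1 /eqP e2 /eqP e3 /eqP e4.
apply/ffunP => i; rewrite ffunE; apply/eqP; rewrite -subr_eq0.
by case: i => [[|[|[|[|//]]]] i4] /=; [move: e1|move: e2|move: e3|move: e4];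
  congr (is_true (_ - c _ == 0)); exact/val_inj.
Qed.

(** The coefficient of [u x] is the reduced trace; in characteristic two scalars have trace zero as
    well. *)
Definition trace_zero : set Q :=
  [set a | exists c0 c1 c2, [/\ C c0, C c1, C c2 & a = c0 + c1 * u + c2 * x]].

Lemma trace_zero_subgroup : add_subgroup trace_zero.
Proof.
split=> [|_ _ [a0 [a1 [a2 [? ? ? ->]]]] [b0 [b1 [b2 [? ? ? ->]]]]].
  by exists 0, 0, 0; split; rewrite ?mul0r ?addr0 //; exact: centroid0.
exists (a0 - b0), (a1 - b1), (a2 - b2); split; try exact: centroidB.
by rewrite !mulrBl !opprD !addrA [LHS](ACl (1*4*2*5*3*6)).
Qed.

Lemma trace_zeroZ c a : C c -> trace_zero a -> trace_zero (c * a).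
Proof.
move=> cC [a0 [a1 [a2 [? ? ? ->]]]].
by exists (c * a0), (c * a1), (c * a2); rewrite !mulrDr !mulrA; split=> //;
  exact: centroidM.
Qed.

Lemma quat_ind (P : set Q) : add_subgroup P ->
  (forall c a, C c -> P a -> P (c * a)) -> P 1 -> P u -> P x -> P (u * x) ->
  A `<=` P.
Proof.
move=> sP PZ P1 Pu Px Pux a /(quat_span ux)[c0 [c1 [c2 [c3 [[? ? ? ?] ->]]]]].
rewrite -[c0]mulr1.
have PD p q : P p -> P q -> P (p + q) by exact: add_subgroupD.
by apply/PD; [apply/PD; [apply/PD|]|]; apply: PZ.
Qed.

Lemma brA_trace_zero a b : A a -> A b -> trace_zero (br a b).
Proof.
have sT := trace_zero_subgroup; have [T0 TB] := sT.
have T1 : trace_zero 1 by exists 1, 0, 0; split; rewrite ?mul0r ?addr0 //;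
  [exact: centroid1|exact: centroid0|exact: centroid0].
have Tu : trace_zero u by exists 0, 1, 0; split; rewrite ?mul0r ?mul1r ?addr0
  ?add0r //; [exact: centroid0|exact: centroid1|exact: centroid0].
have Tx : trace_zero x by exists 0, 0, 1; split; rewrite ?mul0r ?mul1r ?addr0
  ?add0r //; [exact: centroid0|exact: centroid0|exact: centroid1].
move=> Aa Ab; move: b Ab.
have sb (a' : Q) : add_subgroup [set b | trace_zero (br a' b)].
  by split=> [|b b' Tb Tb'] /=; rewrite ?br0r ?brBr //; exact: TB.
have sa (b' : Q) : add_subgroup [set a | trace_zero (br a b')].
  by split=> [|b b'' Tb Tb'] /=; rewrite ?br0l ?brBl //; exact: TB.
apply: (quat_ind (sb a)) => /= [c b cC|||| ]; first by rewrite brZr //;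
  exact: trace_zeroZ.
- by rewrite brCr //; exact: centroid1.
all: move: a Aa; apply: (quat_ind (sa _)) => /= [c a cC Ta|||| ];
  rewrite ?(brCl _ centroid1) ?brr ?brux ?brxu ?br_u_ux ?br_x_ux ?br_ux_u
    ?br_ux_x //.
all: by rewrite brZl //; exact: trace_zeroZ.
Qed.

(** Every basis vector of the right-hand side is a commutator: [1 = [u, x]], [u = [u, u x]] and [x =
    [x, u x]]. *)
Lemma commA_trace_zero : AA = trace_zero.
Proof.
rewrite eqEsubset; split.
  apply: add_gen_sub; first exact: trace_zero_subgroup.
  by move=> _ [a Aa [b Ab <-]]; exact: brA_trace_zero.
move=> _ [c0 [c1 [c2 [? ? ? ->]]]].
have sAA : add_subgroup AA by exact: add_gen_subgroup.
have AAbr a b : A a -> A b -> AA (br a b).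
  by move=> Aa Ab; apply: sub_add_gen; exists a => //; exists b.
rewrite -[c0]mulr1 -[X in c0 * X]brux -[X in c1 * X]br_u_ux
  -[X in c2 * X]br_x_ux -!brZr //.
apply: (add_subgroupD sAA (add_subgroupD sAA _ _));
  by apply: AAbr => //; exact: closureZ.
Qed.

(** Among [1], [u], [x] the only nonzero bracket, up to order, is [[u, x] = 1]. *)
Lemma br_trace_zero a b : trace_zero a -> trace_zero b -> C (br a b).
Proof.
move=> [a0 [a1 [a2 [? ? ? ->]]]] [b0 [b1 [b2 [? ? ? ->]]]].
have brC d d' p q : C d -> C d' -> C (br p q) -> C (br (d * p) (d' * q)).
  by move=> dC d'C pq; rewrite brZl // brZr //; apply: centroidM => //;
    exact: centroidM.
rewrite !(brDl, brDr) !(brCl _ (c := a0)) // !(brCr _ (c := b0)) // !add0r.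
by apply: centroidD; apply: centroidD; apply: brC; rewrite ?brr ?brux ?brxu //;
  first [exact: centroid0|exact: centroid1].
Qed.

(* The scalar is the trace of [l]: in characteristic two, the square of [br l] is
   [br (l * l)], and [l] has a characteristic equation [l * l = c * l + c']. *)
Lemma quat_br_br l : A l -> exists2 c, C c &
  (forall a, br l (br l a) = c * br l a) /\ (c = 0 -> AA l).
Proof.
move=> /(quat_span ux)[c0 [c1 [c2 [c3 [[C0 C1 C2 C3] lE]]]]].
exists c3 => //; split; last first.
  move=> c30; rewrite commA_trace_zero lE c30 mul0r addr0.
  by exists c0, c1, c2.
pose s := c0 + c1 * u + c2 * x.
have ssC : C (s * s).
  rewrite /s sqrqD //; apply: centroidD; first apply: centroidD.
  - by apply: centroid_span_sq (quat_sql ux) _ => //; exists c0, c1.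
  - rewrite -mulrA (mulrCA_C _ _ C2); apply: centroidM => //.
    exact: centroidM (quat_sqr ux).
  - rewrite brDl (brCl _ C0) add0r (brZl _ _ C1) (brZr _ _ C2) brux mulr1.
    exact: centroidM.
have tt : (u * x) * (u * x) = u * x - u * u * (x * x).
  have xu : x * u = u * x - 1 by rewrite -brux /Qs_bracket opprB addrC subrK.
  by rewrite -mulrA (mulrA x) xu mulrBl mul1r mulrBr addrC !Qs_oppr2 // !mulrA.
have st : br s (u * x) = s - c0.
  rewrite /s !brDl (brCl _ C0) (brZl _ _ C1) (brZl _ _ C2) br_u_ux br_x_ux
    add0r.
  by rewrite [RHS](ACl (1*4*2*3)) /= subrr add0r.
rewrite -/s in lE; clearbody s.
have ll : l * l = c3 * l + (s * s + c3 * c0 + c3 * c3 * (u * u * (x * x))).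
  rewrite {1 2}lE sqrqD // (brZr _ _ C3) st -mulrA (mulrCA_C _ _ C3) tt lE.
  rewrite !mulrDr !mulrN !mulrA !(Qs_oppr2 two0) !addrA.
  by rewrite [LHS](ACl (4*2*1*5*3)).
move=> a; rewrite br_br // ll brDl (brZl _ _ C3) [X in _ + X]brCl ?addr0 //.
have [uuC xxC] := (quat_sql ux, quat_sqr ux).
by apply: centroidD;
  [apply: centroidD => //; exact: centroidM|apply: centroidM; exact: centroidM].
Qed.

End Quaternions.

(** * Iterated brackets *)

Section IteratedBrackets.
Context {R : primeRngType}.
Local Notation Q := (Qs R).
Local Notation iota := (@toQs R).
Local Notation C := (extended_centroid R).
Local Notation A := (central_closure R).
Local Notation br := (@Qs_bracket R).
Implicit Types (a b r l : R) (L : set R).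

Lemma rng_bracketBl a b r :
  rng_bracket (a - b) r = rng_bracket a r - rng_bracket b r.
Proof. by apply: toQs_inj; rewrite [RHS]toQsB !toQs_bracket toQsB brBl. Qed.

Lemma rng_bracket0l r : rng_bracket 0 r = 0.
Proof. by apply: toQs_inj; rewrite toQs_bracket toQs0 br0l. Qed.

Lemma rng_bracket_jacobi a b r : rng_bracket (rng_bracket a b) r =
  rng_bracket (rng_bracket a r) b + rng_bracket a (rng_bracket b r).
Proof.
by apply: toQs_inj; rewrite [RHS]toQsD !toQs_bracket br_jacobi.
Qed.

Lemma eq_E m (x y : nat -> R) :
  (forall i, (i < m)%N -> x i = y i) -> E m x = E m y.
Proof.
elim: m => [//|[|m] IHm] xy; first exact: xy.
congr rng_bracket; last exact: xy.
by apply: IHm => i im; apply: xy; exact: ltnW.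
Qed.

Lemma E_plus_subgroup m L : add_subgroup (E_plus m L).
Proof. exact: add_gen_subgroup. Qed.

Lemma E_plus1 L : add_subgroup L -> E_plus 1 L = L.
Proof.
move=> sL; rewrite eqEsubset; split=> [|l Ll].
  by apply: add_gen_sub => // _ [x xL <-]; exact: xL.
by apply: sub_add_gen; exists (fun=> l).
Qed.

Lemma E_plusS_ind m L (P : set R) : add_subgroup P ->
  (forall x l, (forall i, (i < m.+1)%N -> L (x i)) -> L l ->
    P (rng_bracket (E m.+1 x) l)) -> E_plus m.+2 L `<=` P.
Proof.
move=> sP PE; apply: add_gen_sub => // _ [x xL <-].
by apply: PE => [i im|]; apply: xL => //; exact: ltnW.
Qed.

Lemma E_plus_gen m L x : (forall i, (i < m)%N -> L (x i)) -> E_plus m L (E m x).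
Proof. by move=> xL; apply: sub_add_gen; exists x. Qed.

Lemma E_plus_bracket m L a l :
  E_plus m.+1 L a -> L l -> E_plus m.+2 L (rng_bracket a l).
Proof.
move=> + Ll; move: a; pose P := [set a | E_plus m.+2 L (rng_bracket a l)].
suff : E_plus m.+1 L `<=` P by [].
have [S0 SB] := E_plus_subgroup m.+2 L.
apply: add_gen_sub => [|_ [x xL <-]].
  by split=> [|a b Pa Pb]; rewrite /P/= ?rng_bracket0l // rng_bracketBl;
    exact: SB.
(* The sequence [y] puts [l] at index [m.+1], the last one read by [E m.+2]. *)
pose y i := if (i < m.+1)%N then x i else l.
rewrite /P /mkset; have -> : rng_bracket (E m.+1 x) l = E m.+2 y.
  congr rng_bracket; last by rewrite /y ltnn.
  by apply: eq_E => i im; rewrite /y im.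
by apply: E_plus_gen => i _; rewrite /y; case: ifP => // /xL.
Qed.

(** By induction through the Jacobi identity [[[e, l], r] = [[e, r], l] + [e, [l, r]]]: the
    induction hypothesis handles [[e, r]], and [[l, r]] is in [L]. *)
Lemma E_plus_lie_ideal m L : lie_ideal L -> lie_ideal (E_plus m.+1 L).
Proof.
move=> lL; have sL := lL.1; split; first exact: E_plus_subgroup.
apply: add_gen_sub => [|_ [a + [r _ <-]]]; first exact: E_plus_subgroup.
elim: m a r => [|m IHm] a r.
  by rewrite E_plus1 // => La; exact: lie_ideal_bracket.
have sE := E_plus_subgroup m.+2 L; have [S0 SB] := sE.
move: a; pose P := [set a | E_plus m.+2 L (rng_bracket a r)].
suff : E_plus m.+2 L `<=` P by [].
apply: (@E_plusS_ind _ _ P) => [|x l xL Ll].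
  by split=> [|a b Pa Pb]; rewrite /P/= ?rng_bracket0l // rng_bracketBl;
    exact: SB.
rewrite /P/= rng_bracket_jacobi; have Ex := E_plus_gen xL.
by apply: (add_subgroupD sE); apply: E_plus_bracket => //;
  [exact: IHm|exact: lie_ideal_bracket].
Qed.

Lemma E_plus_decr m n L : lie_ideal L -> (0 < m <= n)%N ->
  E_plus n L `<=` E_plus m L.
Proof.
case: m => // m lL /=; elim: n => // n IHn;
  rewrite leq_eqVlt => /predU1P[->//|mn].
apply: subset_trans (IHn mn); case: n mn {IHn} => // n _.
apply: (@E_plusS_ind _ _ (E_plus n.+1 L)) => [|x l xL _];
  first exact: E_plus_subgroup.
exact: (lie_ideal_bracket _ (E_plus_lie_ideal n lL) (E_plus_gen xL)).
Qed.

(** If the decreasing chain becomes central, its last noncentral term serves as [U], because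
    bracketing it with [L] lands in the next term. *)
Lemma E_plus_central_bracket n L : lie_ideal L -> ~ L `<=` rng_center R ->
  ~ E_plus n.+1 L `<=` rng_center R \/
  exists U, [/\ lie_ideal U, ~ U `<=` rng_center R &
    forall u l, U u -> L l -> C (br (iota u) (iota l))].
Proof.
move=> lL LZ; elim: n => [|n [nZ|]]; [|move: nZ|by right].
  by left; rewrite E_plus1 //; exact: lL.1.
have [EZ nZ|] := pselect (E_plus n.+2 L `<=` rng_center R); last by left.
right; exists (E_plus n.+1 L); split=> //; first exact: E_plus_lie_ideal.
move=> u l Eu Ll; rewrite -toQs_bracket; apply/rng_center_toQs; apply: EZ.
exact: E_plus_bracket.
Qed.

(** Bracket [[l, r]] repeatedly with [l]: each step multiplies by [c], the sign being invisible in
    characteristic two. *)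
Lemma E_plus_ad n L l r c : 1 + 1 = 0 :> Q -> lie_ideal L -> L l -> C c ->
  (forall x, br (iota l) (br (iota l) (iota x)) = c * br (iota l) (iota x)) ->
  exists2 a, E_plus n.+1 L a & iota a = c ^+ n * br (iota l) (iota r).
Proof.
move=> two0 lL Ll cC lc; elim: n => [|n [a Ea aE]].
  exists (rng_bracket l r); last by rewrite toQs_bracket expr0 mul1r.
  by rewrite E_plus1; [exact: lie_ideal_bracket|exact: lL.1].
exists (rng_bracket a l); first exact: E_plus_bracket.
rewrite toQs_bracket aE (brZl _ _ (centroidX n cC)) brN Qs_oppr2 // lc mulrA.
by rewrite exprSr.
Qed.

Lemma E_plus_abelian n L : lie_ideal L -> ~ L `<=` rng_center R ->
  (forall a b, E_plus n.+1 L a -> E_plus n.+1 L b -> br (iota a) (iota b) = 0)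
    ->
  exceptional R /\ [set iota a | a in L] `<=` add_gen2 br A A.
Proof.
move=> lL LZ Eab; have lE := E_plus_lie_ideal n lL.
have [two0 [u [uC uR]]] : 1 + 1 = 0 :> Q /\ exists u : R, ~ C (iota u) /\
    forall x, centroid_span (iota u) (br (iota u) (iota x)).
  have [EZ|[U [lU UZ UL]]] := E_plus_central_bracket n lL LZ.
    have [|two0 [u []]] := central_bracket_lie_ideals lE lE EZ EZ.
      by move=> a b Ea Eb; rewrite Eab //; exact: centroid0.
    by split=> //; exists u.
  by have [two0 [u []]] := central_bracket_lie_ideals lU lL UZ LZ UL;
    split=> //; exists u.
have [x ux] :=
  quaternion_pair_of_span two0 (closure_toQs u) uC (centroid_span_br uR).
split.
  split; last exact: (quat_Cdim two0 ux).
  by move=> y; apply: toQs_inj; rewrite mulr2n toQsD Qs_addrr2 // toQs0.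
move=> _ [l Ll <-].
have [lC|lC] := pselect (C (iota l)).
  rewrite (commA_trace_zero two0 ux); exists (iota l), 0, 0.
  by rewrite !mul0r !addr0; split=> //; exact: centroid0.
have [c cC [lc]] := quat_br_br two0 ux (closure_toQs l); apply.
apply: contrapT => c0; apply: (lC); apply: br_centroid => r.
have {}lc y : br (iota l) (br (iota l) (iota y)) = c * br (iota l) (iota y).
  by rewrite lc.
have [k [kC kc _]] := extended_centroid_inv cC c0.
have knC : C (k ^+ n) := centroidX n kC.
have kcn : k ^+ n * c ^+ n = 1 by rewrite -exprMn_comm ?kc ?expr1n //;
  exact: kC.
have brE y :
  exists2 a, E_plus n.+1 L a & br (iota l) (iota y) = k ^+ n * iota a.
  have [a Ea aE] := E_plus_ad n y two0 lL Ll cC lc.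
  by exists a => //; rewrite aE mulrA kcn mul1r.
have lrl y : br (br (iota l) (iota y)) (br (iota l) (iota r)) = 0.
  have [a Ea ->] := brE y; have [b Eb ->] := brE r.
  by rewrite brZl // brZr // Eab // !mulr0.
(* Since [[l, r]] commutes with [[l, R]], it lies in [C + C l]; hence [[l, [l, r]] = c [l, r]]
   vanishes, and so does [[l, r]]. *)
have [|d [dC vC _]] := @posner _ l (rng_bracket l r) lC.
  by move=> y; rewrite toQs_bracket lrl.
have : br (iota l) (br (iota l) (iota r)) = 0.
  rewrite -toQs_bracket -[iota (rng_bracket _ _)](subrK (d * iota l)).
  by rewrite brDr (brCr _ vC) (brZr _ _ dC) brr mulr0 addr0.
by rewrite lc => /(extended_centroid_reg cC)[].
Qed.

End IteratedBrackets.

(** * Central closures of dimension four *)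

Section Dimension4.
Context {R : primeRngType}.
Local Notation Q := (Qs R).
Local Notation iota := (@toQs R).
Local Notation C := (extended_centroid R).
Local Notation A := (central_closure R).
Local Notation br := (@Qs_bracket R).
Implicit Types (p q a b c v : Q) (P : set Q).

(** A derivation [[a, -]] of rank one would make [v] an eigenvector, [v a = k v], because [[a, b a]
    = [a, b] a]. Then [[a, y] (a - k) = 0] for all [y]; taking products [b y] gives [[a, b] y (a -
    k) = 0], and primeness yields [a = k]. *)
Lemma rank1_derivation a v : A a ->
  (forall b, A b -> exists2 c, C c & br a b = c * v) -> C a.
Proof.
move=> Aa av; apply: contrapT => aC; have [b Ab ab0] := not_centroid_closure aC.
have [c cC abE] := av b Ab.
have c0 : c <> 0 by move=> c0; rewrite abE c0 mul0r in ab0.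
have [c' [c'C c'c _]] := extended_centroid_inv cC c0.
have bra y : br a (y * a) = br a y * a by rewrite brMr brr mulr0 addr0.
have [d dC] := av _ (closureM Ab Aa); rewrite bra abE => va.
pose k := c' * d; have kC : C k := centroidM c'C dC.
have {}va : v * a = k * v.
  by rewrite -[v * a]mul1r -c'c -!mulrA [c * (v * a)]mulrA va.
have ak y : A y -> br a y * (a - k) = 0.
  by move=> Ay; have [e eC ->] := av y Ay; rewrite mulrBr -!mulrA va kC subrr.
have [y Ay|//|/eqP] := @closure_prime _ (br a b) (a - k).
  by rewrite -[br a b * y](addrK (b * br a y)) -brMr mulrBl -mulrA !ak ?mulr0
    ?subr0 //; exact: closureM.
by rewrite subr_eq0 => /eqP aE; apply: aC; rewrite aE.
Qed.

Definition adjoin P v : set Q :=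
  [set q | exists p c, [/\ P p, C c & q = p + c * v]].

(** For [P = [set 0]] this is the C-span of [s]; a general [P] lets exchange move vectors one at a
    time out of [s] into [P]. *)
Definition adjoins P (s : seq Q) : set Q := foldr (fun v P => adjoin P v) P s.

Definition subspace P := add_subgroup P /\ forall c p, C c -> P p -> P (c * p).

Lemma adjoin_subspace P v : subspace P -> subspace (adjoin P v).
Proof.
move=> [[P0 PB] PZ]; split; first split.
- by exists 0, 0; split=> //; [exact: centroid0|rewrite mul0r addr0].
- move=> _ _ [p [c [Pp cC ->]]] [q [d [Pq dC ->]]]; exists (p - q), (c - d).
  by split; [exact: PB|exact: centroidB|rewrite mulrBl opprD addrACA].
move=> k _ kC [p [c [Pp cC ->]]]; exists (k * p), (k * c).
by split; [exact: PZ|exact: centroidM|rewrite mulrDr mulrA].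
Qed.

Lemma adjoins_subspace P s : subspace P -> subspace (adjoins P s).
Proof. by move=> sP; elim: s => //= v s; exact: adjoin_subspace. Qed.

Lemma sub_adjoin P v : P `<=` adjoin P v.
Proof.
by move=> p Pp; exists p, 0; split=> //; [exact: centroid0|rewrite mul0r addr0].
Qed.

Lemma mem_adjoin P v : subspace P -> adjoin P v v.
Proof.
by move=> [[P0 _] _]; exists 0, 1; split=> //;
  [exact: centroid1|rewrite mul1r add0r].
Qed.

Lemma adjoin_mono P P' v : P `<=` P' -> adjoin P v `<=` adjoin P' v.
Proof.
by move=> PP' _ [p [c [Pp cC ->]]]; exists p, c; split=> //; exact: PP'.
Qed.

Lemma adjoins_mono P P' s : P `<=` P' -> adjoins P s `<=` adjoins P' s.
Proof. by move=> PP'; elim: s => //= v s; exact: adjoin_mono. Qed.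

Lemma sub_adjoins P s : P `<=` adjoins P s.
Proof.
by elim: s => //= v s IHs; apply: subset_trans IHs _; exact: sub_adjoin.
Qed.

(** The first vector of [s] with a nonzero coefficient in [b] is solved for in terms of [b] and the
    later ones, and dropped. *)
Lemma steinitz_exchange P s b : subspace P -> adjoins P s b -> ~ P b ->
  exists2 s', size s = (size s').+1 & adjoins P s `<=` adjoins (adjoin P b) s'.
Proof.
move=> sP + Pb; elim: s => [//|v s IHs] /= [p [c [sp cC bE]]].
have [c0|c0] := pselect (c = 0).
  rewrite c0 mul0r addr0 in bE; rewrite -bE in sp.
  have [s' sz ss'] := IHs sp; exists (v :: s'); rewrite /= ?sz //.
  exact: adjoin_mono.
have [c' [c'C c'c _]] := extended_centroid_inv cC c0.
exists s => // _ [q [d [sq dC ->]]].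
have sPb := adjoin_subspace b sP.
have [sB sZ] := adjoins_subspace s sPb.
have incl : adjoins P s `<=` adjoins (adjoin P b) s.
  by apply: adjoins_mono; exact: sub_adjoin.
have -> : v = c' * (b - p) by rewrite bE addrC addKr mulrA c'c mul1r.
apply: (add_subgroupD sB); first exact: incl.
apply: (sZ _ _ dC); apply: (sZ _ _ c'C); apply: (sB.2); last exact: incl.
by apply: sub_adjoins; exact: mem_adjoin.
Qed.

Lemma zero_subspace : subspace [set 0].
Proof.
split; first by split=> // _ _ -> ->; exact: subrr.
by move=> c _ _ ->; exact: mulr0.
Qed.

Lemma Cdim_adjoins n : has_Cdim A n ->
  exists2 s, size s = n & A `<=` adjoins [set 0] s.
Proof.
move=> [v [_ vA]]; exists [seq v i | i <- enum 'I_n].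
  by rewrite size_map size_enum_ord.
move=> a /vA[c [[cC ->] _]]; rewrite -big_enum /=.
elim: (enum 'I_n) => [|i s IHs] /=; first by rewrite big_nil.
by rewrite big_cons addrC; exists (\sum_(j <- s) c j * v j), (c i).
Qed.

Context (two0 : 1 + 1 = 0 :> Q) (dim4 : has_Cdim A 4).

(* Otherwise [b1], [b2], [b3] and a single [v] span RC, so that the range of
   [br a] is spanned by [br a v]. *)
Lemma centralizer_dependent a b1 b2 b3 : A a -> ~ C a ->
  A b1 -> A b2 -> A b3 -> br a b1 = 0 -> br a b2 = 0 -> br a b3 = 0 ->
  b1 <> 0 -> (forall c, C c -> b2 <> c * b1) ->
  exists c d, [/\ C c, C d & b3 = c * b1 + d * b2].
Proof.
move=> Aa aC A1 A2 A3 a1 a2 a3 b10 b21; apply: contrapT => b321; apply: aC.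
have [s sz As] := Cdim_adjoins dim4.
have sP0 := zero_subspace; have sP1 := adjoin_subspace b1 sP0.
have sP2 := adjoin_subspace b2 sP1.
have [s1 sz1 As1] := steinitz_exchange sP0 (As _ A1) b10.
have [|s2 sz2 As2] := steinitz_exchange sP1 (As1 _ (As _ A2)).
  by move=> [p [c [-> cC b2E]]]; apply: (b21 c cC); rewrite b2E add0r.
have [|s3 sz3 As3] := steinitz_exchange sP2 (As2 _ (As1 _ (As _ A3))).
  move=> [_ [d [[p [c [-> cC ->]]] dC b3E]]]; apply: b321.
  by exists c, d; rewrite b3E add0r.
move: sz; rewrite sz1 sz2 sz3 => -[].
case: s3 sz3 As3 => [|v [|//]] //= _ As3 _.
apply: (@rank1_derivation _ (br a v)) => // b Ab.
have [_ [c [[_ [c3 [[_ [c2 [[_ [c1 [-> C1 ->]]] C2 ->]]] C3 ->]]] cC ->]]] :=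
  As3 _ (As2 _ (As1 _ (As _ Ab))).
exists c => //; rewrite add0r !brDr (brZr _ _ C1) (brZr _ _ C2) (brZr _ _ C3).
by rewrite a1 a2 a3 !mulr0 !add0r brZr.
Qed.

(** By [centralizer_dependent] the centralizer of a noncentral [z] is spanned by [z] and at most one
    more element, so it is commutative. *)
Lemma centralizes_noncommuting z p q : A z -> A p -> A q ->
  br z p = 0 -> br z q = 0 -> br p q <> 0 -> C z.
Proof.
move=> Az Ap Aq zp zq pq; apply: contrapT => zC.
have [|c cC pE|c [d [cC dC qE]]] :=
  centralizer_dependent Az zC Az Ap Aq (brr z) zp zq.
- by move=> z0; apply: zC; rewrite z0; exact: centroid0.
- by apply: pq; rewrite pE brZl // zq mulr0.
- by apply: pq; rewrite qE brDr !brZr // brr (brN z) zp oppr0 !mulr0 addr0.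
Qed.

(** * Existence of a unit in the central closure, by contradiction *)

Section NoUnit.
Context (A_C : forall z, A z -> C z -> z = 0).

Let A_notC a : A a -> a <> 0 -> ~ C a.
Proof. by move=> Aa a0 aC; apply: a0; exact: A_C. Qed.

(** Since [[a, [a, b]] = [a * a, b] = 0], the range of [[a, -]] centralizes [a]. It has rank at
    least two, so [a], [[a, b]] and [[a, b']] can be chosen with the first two independent and
    [[a, b']] outside [C [a, b]]; their dependence puts [a] in the range. *)
Lemma nilpotent_eigenvector a : A a -> a <> 0 -> a * a = 0 ->
  exists2 x, A x & br a x = a.
Proof.
move=> Aa a0 aa; have aC := A_notC Aa a0.
have brbr b : br a (br a b) = 0 by rewrite br_br // aa br0l.
have [b Ab bE] : exists2 b, A b & forall c, C c -> br a b <> c * a.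
  apply: contrapT => nb; apply: aC; apply: (@rank1_derivation _ a) => // b Ab.
  apply: contrapT => nc; apply: nb; exists b => // c cC bE.
  by apply: nc; exists c.
have [b' Ab' b'E] : exists2 b', A b' & forall c, C c -> br a b' <> c * br a b.
  apply: contrapT => nb; apply: aC;
    apply: (@rank1_derivation _ (br a b)) => // b' Ab'.
  apply: contrapT => nc; apply: nb; exists b' => // c cC b'E.
  by apply: nc; exists c.
have [c [d [cC dC b'ab]]] := centralizer_dependent Aa aC Aa (closure_br Aa Ab)
  (closure_br Aa Ab') (brr a) (brbr b) (brbr b') a0 bE.
have c0 : c <> 0 by move=> c0; apply: (b'E d dC); rewrite b'ab c0 mul0r add0r.
have [k [kC kc _]] := extended_centroid_inv cC c0.
exists (k * (b' - d * b)).
  by apply: closureZ => //; apply: closureB => //; exact: closureZ.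
by rewrite brZr // brBr brZr // b'ab addrK mulrA kc mul1r.
Qed.

Lemma exists_idempotent : exists e, [/\ A e, e * e = e & e <> 0].
Proof.
have [[a [Aa a0 aa]]|red] := pselect (exists a, [/\ A a, a <> 0 & a * a = 0]).
  have [x Ax ax] := nilpotent_eigenvector Aa a0 aa.
  have Ax2 : A (x * x + x) by apply: closureD => //; exact: closureM.
  (* From [[a, x] = a] it follows that [x * x + x] commutes with the noncommuting elements [a] and
     [x], so it is central, hence zero, and [x] is idempotent. *)
  have xx : x * x + x = 0.
    apply: A_C => //; apply: (centralizes_noncommuting Ax2 Aa Ax).
    - rewrite brN brDr brMr ax addrC.
      suff -> : a * x + x * a = a by rewrite Qs_addrr2 // oppr0.
      by rewrite -[RHS]ax /Qs_bracket Qs_oppr2.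
    - by rewrite brDl brMl brr mulr0 mul0r !addr0.
    - by rewrite ax.
  exists x; split=> //; first by rewrite -[RHS]Qs_oppr2 //; apply/eqP;
    rewrite -addr_eq0 xx.
  by move=> x0; apply: a0; rewrite -ax x0 br0r.
have {}red a : A a -> a * a = 0 -> a = 0.
  by move=> Aa aa; apply: contrapT => a0; apply: red; exists a.
have scale a c : A a -> a <> 0 -> C c -> a * a = c * a ->
    exists e, [/\ A e, e * e = e & e <> 0].
  move=> Aa a0 cC aa; have c0 : c <> 0.
    by move=> c0; apply: a0; apply: red => //; rewrite aa c0 mul0r.
  have [k [kC kc k0]] := extended_centroid_inv cC c0.
  exists (k * a); split; first exact: closureZ.
    by rewrite -mulrA (mulrCA_C _ _ kC) aa [k * (c * a)]mulrA kc mul1r.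
  by move/(extended_centroid_reg kC)=> [].
have [x0 x00] := @prime_rng_nonzero R.
have [a Aa a0] : exists2 a, A a & a <> 0.
  by exists (iota x0); [exact: closure_toQs|move=> /toQs_eq0].
have [[c cC aa]|aa] := pselect (exists2 c, C c & a * a = c * a).
  exact: scale aa.
have Aaa := closureM Aa Aa; have bra : br a (a * a) = 0.
  by rewrite brMr brr mul0r mulr0 addr0.
have bra3 : br a (a * (a * a)) = 0 by rewrite brMr brr bra mul0r mulr0 addr0.
(* The powers [a], [a^2], [a^3] commute with [a], so [a^3 = c a + d a^2]. If [c = 0], the element
   [a^2 - d a] squares to zero; otherwise, divided by [c], it fixes [a] and is idempotent. *)
have [|c [d [cC dC aaa]]] := centralizer_dependent Aa (A_notC Aa a0)
  Aa Aaa (closureM Aa Aaa) (brr a) bra bra3 a0.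
  by move=> c cC aaE; apply: aa; exists c.
have [c0|c0] := pselect (c = 0).
  exfalso; apply: aa; exists d => //.
  pose g := a * a - d * a; have ag : a * g = 0.
    by rewrite mulrBr (mulrCA_C _ _ dC) aaa c0 mul0r add0r subrr.
  have g0 : g = 0.
    apply: red; first by apply: closureB => //; exact: closureZ.
    by rewrite mulrBl -!mulrA ag !mulr0 subrr.
  by apply/eqP; rewrite -subr_eq0 -/g g0.
have [k [kC kc _]] := extended_centroid_inv cC c0.
pose e := k * (a * a - d * a); have ae : a * e = a.
  by rewrite (mulrCA_C _ _ kC) mulrBr (mulrCA_C _ _ dC) aaa addrK mulrA kc
    mul1r.
exists e; split.
- by apply: closureZ => //; apply: closureB => //; exact: closureZ.
- by rewrite {1}/e -mulrA mulrBl -!mulrA ae.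
- by move=> e0; apply: a0; rewrite -ae e0 mulr0.
Qed.

(* With [f := 1 - e], the elements [p := e y f] and [q := f y' e] have square
   zero, so that [br p q = p q + q p] commutes with both, hence is central. *)
Lemma no_unit_absurd : False.
Proof.
have [e [Ae ee e0]] := exists_idempotent.
pose f : Q := 1 - e.
have fe : f * e = 0 by rewrite mulrBl mul1r ee subrr.
have ef : e * f = 0 by rewrite mulrBr mulr1 ee subrr.
have f0 : f <> 0.
  move=> /eqP; rewrite subr_eq0 => /eqP e1; apply: e0; apply: A_C => //.
  by rewrite -e1; exact: centroid1.
suff efe y y' : A y -> A y' -> e * y * f * y' * e = 0.
  have [] // := @closure_prime _ e f => y Ay.
  by have [] // := @closure_prime _ (e * y * f) e => y' Ay'; exact: efe.
move=> Ay Ay'; pose p := e * y * f; pose q := f * y' * e.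
have Ap : A p by rewrite /p mulrBr mulr1; apply: closureB; do !apply: closureM.
have Aq : A q by rewrite /q mulrBl mul1r mulrBl; apply: closureB;
  do !apply: closureM.
have pp : p * p = 0 by rewrite /p -!mulrA (mulrA f e) fe mul0r !mulr0.
have qq : q * q = 0 by rewrite /q -!mulrA (mulrA e f) ef mul0r !mulr0.
have pq : br p q = 0.
  apply: contrapT => pq; apply: (pq); apply: A_C; first exact: closure_br.
  apply: (centralizes_noncommuting (closure_br Ap Aq) Ap Aq) => //.
    by rewrite brN br_br // pp br0l oppr0.
  by rewrite (brN q) (brN q p) brNr opprK br_br // qq br0l.
have /(congr1 ( *%R e)) := br_eq0 pq.
rewrite /p /q !mulrA ee ef !mul0r -!mulrA (mulrA f f).
have -> : f * f = f by rewrite {1}mulrBl mul1r ef subr0.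
by [].
Qed.
End NoUnit.

(** A nonzero scalar in RC can be rescaled to [1], so if [1] were missing, [no_unit_absurd] would
    apply. *)
Lemma closure1 : A 1.
Proof.
apply: contrapT => A1; apply: no_unit_absurd => z Az zC.
apply: contrapT => z0; have [k [kC kz _]] := extended_centroid_inv zC z0.
by apply: A1; rewrite -kz; exact: closureZ.
Qed.

Let one_neq0 : 1 <> 0 :> Q. Proof. by apply/eqP; exact: oner_neq0. Qed.

Lemma centralizer_span a b : A a -> ~ C a -> A b -> br a b = 0 ->
  centroid_span a b.
Proof.
move=> Aa aC Ab ab.
have [|c [d [cC dC ->]]] := centralizer_dependent Aa aC closure1 Aa Ab
  (brCr a centroid1) (brr a) ab one_neq0.
  by move=> c cC aE; apply: aC; rewrite aE mulr1.
by exists c, d; rewrite mulr1.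
Qed.

(** As [a] has a quadratic equation [a * a = c + d a], the derivation [[a, -]] multiplies [w =
    [a, b]] by [d] and so sends [w * w] to [2 d w * w = 0]. By symmetry [w * w] also commutes with
    [b], hence is central. *)
Lemma sqr_bracket_centroid a b : A a -> A b -> C (br a b * br a b).
Proof.
move=> Aa Ab; have [ab|ab] := pselect (br a b = 0).
  by rewrite ab mul0r; exact: centroid0.
have Aw := closure_br Aa Ab; set w := br a b in ab Aw *.
have sqr p q : A p -> br p q <> 0 -> br p (br p q * br p q) = 0.
  move=> Ap pq; have pC : ~ C p by move=> pC; rewrite brCl in pq.
  have [|c [d [cC dC ppE]]] := centralizer_span Ap pC (closureM Ap Ap).
    by rewrite brMr brr mul0r mulr0 addr0.
  rewrite brMr br_br // ppE brDl brCl // add0r brZl //.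
  by rewrite -mulrA (mulrCA_C _ _ dC) Qs_addrr2.
apply: (centralizes_noncommuting (closureM Aw Aw) Aa Ab) => //.
  by rewrite brN sqr // oppr0.
have ba : br b a = w by rewrite brN Qs_oppr2.
by rewrite brN -ba sqr ?ba ?oppr0.
Qed.

(** By [rank1_derivation] with [v = 1], some commutator [w] is not a scalar. Its square is, so
    [[w, y]] centralizes [w] and lies in [C + C w]. *)
Lemma Cdim4_quaternion_pair : (exists2 a, A a & ~ C a) ->
  exists u x : Q, quaternion_pair u x.
Proof.
move=> [a Aa aC]; have [b Ab wC] : exists2 b, A b & ~ C (br a b).
  apply: contrapT => nb; apply: aC; apply: (@rank1_derivation _ 1) => // b Ab.
  exists (br a b); last by rewrite mulr1.
  by apply: contrapT => wC; apply: nb; exists b.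
have Aw := closure_br Aa Ab; exists (br a b).
apply: quaternion_pair_of_span => // y Ay.
apply: centralizer_span => //; first exact: closure_br.
by rewrite br_br // brCl //; exact: sqr_bracket_centroid.
Qed.

End Dimension4.

(** * The exceptional case and the equivalence *)

Section Exceptional.
Context {R : primeRngType}.
Local Notation Q := (Qs R).
Local Notation iota := (@toQs R).
Local Notation C := (extended_centroid R).
Local Notation A := (central_closure R).
Local Notation br := (@Qs_bracket R).

Lemma exceptional_bracket_central (L : set R) :
  exceptional R -> ~ L `<=` rng_center R ->
  [set iota a | a in L] `<=` add_gen2 br A A ->
  forall a b, L a -> L b -> rng_center R (rng_bracket a b).
Proof.
move=> [R2 dim4] LZ LAA a b La Lb.
have two0 : 1 + 1 = 0 :> Q.
  have [r r0] := @prime_rng_nonzero R.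
  have c2 : (1 + 1) * iota r = 0.
    by rewrite mulrDl mul1r -toQsD -mulr2n R2 toQs0.
  by have [|/toQs_eq0/r0] :=
    extended_centroid_reg (centroidD (@centroid1 R) (@centroid1 R)) c2.
have [l Ll lC] := not_sub_center LZ.
have [|u [x ux]] := Cdim4_quaternion_pair two0 dim4.
  by exists (iota l) => //; exact: closure_toQs.
apply/rng_center_toQs; rewrite toQs_bracket.
apply: (br_trace_zero two0 ux); rewrite -(commA_trace_zero two0 ux);
  by apply: LAA; eexists; [|reflexivity].
Qed.

(** Brackets of length two are central by hypothesis, and longer ones vanish. *)
Lemma E_plus_central (L : set R) m :
  (forall a b, L a -> L b -> rng_center R (rng_bracket a b)) ->
  E_plus m.+2 L `<=` rng_center R.
Proof.
move=> LL; apply: E_plusS_ind => [|x l xL Ll].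
  split=> [r|a b aZ bZ r]; first by rewrite rng_mul0r rng_mulr0.
  by rewrite rng_mulDl rng_mulDr rng_mulNr rng_mulrN aZ bZ.
elim: m l xL Ll => [|m IHm] l xL Ll; first by apply: LL => //; exact: xL.
apply/rng_center_toQs; rewrite toQs_bracket brCl; first exact: centroid0.
by apply/rng_center_toQs; apply: IHm => [i im|]; apply: xL => //; exact: ltnW.
Qed.

End Exceptional.

Theorem theoremD (R : primeRngType) (L : set R) (m k : nat)
    (hL : lie_ideal L) (hLnc : ~ (L `<=` rng_center R))
    (hm : (1 <= m)%N) (hk : (1 <= k)%N) (hmk : (1 < m)%N \/ (1 < k)%N) :
  add_gen2 (@rng_bracket R) (E_plus m L) (E_plus k L) = [set 0] <->
  exceptional R /\
  [set toQs a | a in L] `<=`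
    add_gen2 (@Qs_bracket R) (central_closure R) (central_closure R).
Proof.
split=> [EE|[exc LAA]].
  have [n nE] : exists n, maxn m k = n.+1.
    by exists (maxn m k).-1; rewrite prednK // leq_max hm.
  apply: (@E_plus_abelian _ n) => // a b Ea Eb.
  have Em : E_plus m L a.
    by apply: (E_plus_decr (n := n.+1)) => //; rewrite hm -nE leq_maxl.
  have Ek : E_plus k L b.
    by apply: (E_plus_decr (n := n.+1)) => //; rewrite hk -nE leq_maxr.
  rewrite -toQs_bracket; suff -> : rng_bracket a b = 0 by exact: toQs0.
  suff : [set 0] (rng_bracket a b) by [].
  by rewrite -EE; apply: sub_add_gen; exists a => //; exists b.
have LL := exceptional_bracket_central exc hLnc LAA.
rewrite eqEsubset; split; last by move=> _ ->; case: (add_gen_subgroup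
  [set rng_bracket a b | a in E_plus m L & b in E_plus k L]).
apply: add_gen_sub; first by split=> // _ _ -> ->; exact: subrr.
have EZ n : (1 < n)%N -> E_plus n L `<=` rng_center R.
  by case: n => [|[|n]] // _; exact: E_plus_central.
move=> _ [a Ea [b Eb <-]]; rewrite /= /rng_bracket.
by case: hmk => [/EZ Z|/EZ Z]; rewrite ?(Z _ Ea) ?(Z _ Eb) subrr.
Qed.
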